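(* Let $p$ be an odd prime, let $m\geqslant 3$ be an integer, and let $\mathcal{H}=\langle a,b \mid a^{p^m}=b^p=1,\ b^{-1}ab=a^{p^{m-1}+1}\rangle$. For any positive integer $n$, there is an isomorphism of abelian groups $$Q_n(\mathcal{H})\cong\begin{cases}(C_p)^{(m-1)p+2}, & n=1,\\ (C_p)^{(m-1)p+m+2}, & n\geqslant 2.\end{cases}$$
   Context: For a finite group $G$, a $G$-set is a finite set with a $G$-action, and $[X]$ denotes the isomorphism class of a $G$-set $X$. The Burnside ring $\Omega(G)$ is the group completion of the monoid of isomorphism classes of $G$-sets under $[X]+[Y]=[X\sqcup Y]$ (disjoint union), with multiplication induced by cartesian product $[X][Y]=[X\times Y]$ ($G$ acting diagonally). The augmentation map is the ring homomorphism $\phi:\Omega(G)\to\mathbb{Z}$ induced by sending $[X]$ to the number of points of $X$ fixed by all of $G$. The augmentation ideal is $\Delta(G)=\ker\phi$, $\Delta^n(G)$ is the $n$-th power of the ideal $\Delta(G)$, and the $n$-th augmentation quotient group is $Q_n(G)=\Delta^n(G)/\Delta^{n+1}(G)$. $C_p$ denotes the cyclic group of order $p$, and $(C_p)^r$ the direct product of $r$ copies of it. *)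

(* Defs.v *)
From HB Require Import structures.
From mathcomp Require Import all_boot all_order all_algebra all_fingroup.
From mathcomp Require Import boolp ring.

Set Implicit Arguments.
Unset Strict Implicit.
Unset Printing Implicit Defensive.

Import generic_quotient GRing.Theory.

Local Open Scope ring_scope.
Local Open Scope quotient_scope.

Section GroupCompletion.
Variable S : comPzSemiRingType.

(* The pair (x, y) stands for the formal difference x - y.  The extra summand
   z is needed because addition in S need not be cancellative. *)
Definition gc_equiv (u v : S * S) := `[< exists z, u.1 + v.2 + z = v.1 + u.2 + z >].

Lemma gc_equivP u v :
  reflect (exists z, u.1 + v.2 + z = v.1 + u.2 + z) (gc_equiv u v).
Proof. exact: asboolP. Qed.

Lemma gc_equiv_refl : reflexive gc_equiv.
Proof. by move=> u; apply/gc_equivP; exists 0. Qed.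

Lemma gc_equiv_sym : symmetric gc_equiv.
Proof.
by move=> u v; apply/gc_equivP/gc_equivP => -[z e]; exists z; rewrite e.
Qed.

Lemma gc_equiv_trans : transitive gc_equiv.
Proof.
move=> v u w /gc_equivP[z e] /gc_equivP[t f]; apply/gc_equivP.
exists (v.1 + v.2 + z + t).
have -> : u.1 + w.2 + (v.1 + v.2 + z + t) =
          (u.1 + v.2 + z) + (v.1 + w.2 + t).
  by rewrite [LHS](AC (2*4) ((1*4*5)*(3*2*6))).
rewrite e f.
by rewrite [LHS](AC (3*3) ((4*2)*(1*5*3*6))).
Qed.

Canonical gc_equiv_rel :=
  EquivRel gc_equiv gc_equiv_refl gc_equiv_sym gc_equiv_trans.

Definition gcompletion := {eq_quot gc_equiv}.

HB.instance Definition _ := Choice.on gcompletion.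
HB.instance Definition _ : EqQuotient _ gc_equiv gcompletion :=
  EqQuotient.on gcompletion.

Definition gc_pair (x y : S) : gcompletion := \pi_gcompletion (x, y).

Lemma gc_pairP x y x' y' :
  gc_pair x y = gc_pair x' y' <-> exists z, x + y' + z = x' + y + z.
Proof.
split; first by move=> /eqquotP/gc_equivP.
by move=> e; apply/eqquotP/gc_equivP.
Qed.

Lemma gc_pair_repr (q : gcompletion) : q = gc_pair (repr q).1 (repr q).2.
Proof. by rewrite /gc_pair -surjective_pairing reprK. Qed.

Lemma gc_ind (P : gcompletion -> Prop) :
  (forall x y, P (gc_pair x y)) -> forall q, P q.
Proof. by move=> h q; rewrite [q]gc_pair_repr. Qed.

Definition gc_zero := gc_pair 0 0.
Definition gc_one := gc_pair 1 0.
Definition gc_opp (q : gcompletion) := gc_pair (repr q).2 (repr q).1.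
Definition gc_add (q r : gcompletion) :=
  gc_pair ((repr q).1 + (repr r).1) ((repr q).2 + (repr r).2).
Definition gc_mul (q r : gcompletion) :=
  gc_pair ((repr q).1 * (repr r).1 + (repr q).2 * (repr r).2)
          ((repr q).1 * (repr r).2 + (repr q).2 * (repr r).1).

Lemma gc_reprP x y : exists z,
  (repr (gc_pair x y)).1 + y + z = x + (repr (gc_pair x y)).2 + z.
Proof. by apply/gc_pairP; rewrite -gc_pair_repr. Qed.

Lemma gc_oppE x y : gc_opp (gc_pair x y) = gc_pair y x.
Proof.
have [z e] := gc_reprP x y; apply/gc_pairP; exists z.
by rewrite [_ + x]addrC -e addrC [_ + z]addrC [y + _]addrC.
Qed.

Lemma gc_addE x y u v :
  gc_add (gc_pair x y) (gc_pair u v) = gc_pair (x + u) (y + v).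
Proof.
have [z e] := gc_reprP x y; have [t f] := gc_reprP u v.
rewrite /gc_add; case: (repr (gc_pair x y)) e => x1 y1 /= e.
case: (repr (gc_pair u v)) f => u1 v1 /= f.
apply/gc_pairP; exists (z + t).
transitivity ((x1 + y + z) + (u1 + v + t)); first by ring.
by rewrite e f; ring.
Qed.

Lemma gc_mulE x y u v :
  gc_mul (gc_pair x y) (gc_pair u v) =
  gc_pair (x * u + y * v) (x * v + y * u).
Proof.
have [z e] := gc_reprP x y; have [t f] := gc_reprP u v.
rewrite /gc_mul; case: (repr (gc_pair x y)) e => x1 y1 /= e.
case: (repr (gc_pair u v)) f => u1 v1 /= f.
transitivity (gc_pair (x * u1 + y * v1) (x * v1 + y * u1)).
  apply/gc_pairP; exists (z * u1 + z * v1).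
  transitivity ((x1 + y + z) * u1 + (x + y1 + z) * v1); first by ring.
  transitivity ((x + y1 + z) * u1 + (x1 + y + z) * v1); last by ring.
  by rewrite e.
apply/gc_pairP; exists (x * t + y * t).
transitivity (x * (u1 + v + t) + y * (u + v1 + t)); first by ring.
transitivity (x * (u + v1 + t) + y * (u1 + v + t)); last by ring.
by rewrite f.
Qed.

Definition gcE := (gc_oppE, gc_addE, gc_mulE).

Lemma gc_addA : associative gc_add.
Proof.
elim/gc_ind=> x y; elim/gc_ind=> z t; elim/gc_ind=> u v.
by rewrite !gcE !addrA.
Qed.

Lemma gc_addC : commutative gc_add.
Proof.
elim/gc_ind=> x y; elim/gc_ind=> z t.
by rewrite !gcE [x + z]addrC [y + t]addrC.
Qed.

Lemma gc_add0 : left_id gc_zero gc_add.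
Proof. by elim/gc_ind=> x y; rewrite gcE !add0r. Qed.

Lemma gc_addN : left_inverse gc_zero gc_opp gc_add.
Proof.
elim/gc_ind=> x y; rewrite !gcE; apply/gc_pairP; exists 0.
by rewrite !addr0 add0r addrC.
Qed.

HB.instance Definition _ :=
  GRing.isZmodule.Build gcompletion gc_addA gc_addC gc_add0 gc_addN.

Lemma gc_mulA : associative gc_mul.
Proof.
elim/gc_ind=> x y; elim/gc_ind=> z t; elim/gc_ind=> u v.
by rewrite !gcE; congr gc_pair; ring.
Qed.

Lemma gc_mulC : commutative gc_mul.
Proof.
elim/gc_ind=> x y; elim/gc_ind=> z t.
by rewrite !gcE; congr gc_pair; ring.
Qed.

Lemma gc_mul1 : left_id gc_one gc_mul.
Proof.
by elim/gc_ind=> x y; rewrite gcE !mul1r !mul0r !addr0.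
Qed.

Lemma gc_mulDl : left_distributive gc_mul gc_add.
Proof.
elim/gc_ind=> x y; elim/gc_ind=> z t; elim/gc_ind=> u v.
by rewrite !gcE; congr gc_pair; ring.
Qed.

HB.instance Definition _ := GRing.Zmodule_isComPzRing.Build gcompletion
  gc_mulA gc_mulC gc_mul1 gc_mulDl.

Lemma gc_pairB x y x' y' :
  gc_pair x y - gc_pair x' y' = gc_pair (x + y') (y + x').
Proof. by rewrite -gc_addE -(gc_oppE x' y'). Qed.

Lemma gc_pairM x y x' y' :
  gc_pair x y * gc_pair x' y' = gc_pair (x * x' + y * y') (x * y' + y * x').
Proof. exact: gc_mulE. Qed.

Definition gc_inj (x : S) : gcompletion := gc_pair x 0.

Lemma gc_inj_is_nmod_morphism : nmod_morphism gc_inj.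
Proof. by split=> [|x y] //; rewrite -[RHS]/(gc_add _ _) gcE addr0. Qed.

Lemma gc_inj_is_monoid_morphism : monoid_morphism gc_inj.
Proof. by split=> [|x y]; rewrite // gc_pairM !(mulr0, mul0r, addr0). Qed.

HB.instance Definition _ :=
  GRing.isNmodMorphism.Build S gcompletion gc_inj gc_inj_is_nmod_morphism.
HB.instance Definition _ :=
  GRing.isMonoidMorphism.Build S gcompletion gc_inj gc_inj_is_monoid_morphism.

Lemma gc_pairE x y : gc_pair x y = gc_inj x - gc_inj y.
Proof. by rewrite gc_pairB addr0 add0r. Qed.

Section Lift.
Variables (R : pzRingType) (f : {rmorphism S -> R}).

Definition gc_lift (q : gcompletion) : R := f (repr q).1 - f (repr q).2.

Lemma gc_liftE x y : gc_lift (gc_pair x y) = f x - f y.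
Proof.
have [z e] := gc_reprP x y; rewrite /gc_lift.
move: (repr _) e => [x1 y1] /= /(congr1 f); rewrite !rmorphD => /addIr e.
by apply/eqP; rewrite subr_eq addrAC -e addrK.
Qed.

Lemma gc_lift_inj x : gc_lift (gc_inj x) = f x.
Proof. by rewrite gc_liftE rmorph0 subr0. Qed.

Lemma gc_lift_is_zmod_morphism : zmod_morphism gc_lift.
Proof.
elim/gc_ind=> x y; elim/gc_ind=> z t.
by rewrite gc_pairB !gc_liftE !rmorphD opprB opprD addrACA.
Qed.

Lemma gc_lift_is_monoid_morphism : monoid_morphism gc_lift.
Proof.
split; first by rewrite gc_lift_inj rmorph1.
elim/gc_ind=> x y; elim/gc_ind=> z t.
rewrite gc_pairM !gc_liftE !rmorphD !rmorphM mulrBl !mulrBr opprB opprD.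
by rewrite addrACA.
Qed.

HB.instance Definition _ :=
  GRing.isZmodMorphism.Build gcompletion R gc_lift gc_lift_is_zmod_morphism.
HB.instance Definition _ :=
  GRing.isMonoidMorphism.Build gcompletion R gc_lift gc_lift_is_monoid_morphism.

End Lift.

End GroupCompletion.

Section IdealPowers.
Variable R : comPzRingType.

Definition ideal_mul (I J : {pred R}) : {pred R} := fun x =>
  `[< exists2 s : seq (R * R),
        {in s, forall u, u.1 \in I /\ u.2 \in J}
      & x = \sum_(u <- s) u.1 * u.2 >].

Fixpoint ideal_exp (I : {pred R}) (n : nat) : {pred R} :=
  if n is n'.+1 then ideal_mul I (ideal_exp I n') else predT.

Lemma ideal_mulP (I J : {pred R}) x :
  reflect (exists2 s : seq (R * R),
             {in s, forall u, u.1 \in I /\ u.2 \in J}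
           & x = \sum_(u <- s) u.1 * u.2)
          (x \in ideal_mul I J).
Proof. exact: asboolP. Qed.

Lemma mem_ideal_mul (I J : {pred R}) x y :
  x \in I -> y \in J -> x * y \in ideal_mul I J.
Proof.
move=> Ix Jy; apply/ideal_mulP; exists [:: (x, y)]; last by rewrite big_seq1.
by move=> u; rewrite inE => /eqP->.
Qed.

Lemma ideal_exp_closed (I : zmodClosed R) n : zmod_closed (ideal_exp I n).
Proof.
case: n => [|n] //; split.
  by apply/ideal_mulP; exists [::]; rewrite ?big_nil.
move=> _ _ /ideal_mulP[s sI ->] /ideal_mulP[t tI ->]; apply/ideal_mulP.
exists (s ++ [seq (- u.1, u.2) | u <- t]).
  move=> u; rewrite mem_cat => /orP[/sI //|/mapP[v /tI[Iv Jv] ->]].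
  by rewrite rpredN.
rewrite big_cat big_map -sumrN; congr (_ + _).
by apply: eq_bigr => u _; rewrite mulNr.
Qed.

HB.instance Definition _ (I : zmodClosed R) n :=
  GRing.isZmodClosed.Build R (ideal_exp I n) (ideal_exp_closed I n).

Lemma ideal_expM (I : {pred R}) n a x :
  x \in ideal_exp I n -> a * x \in ideal_exp I n.
Proof.
elim: n a x => [|n IHn] a x // /ideal_mulP[s sI ->]; apply/ideal_mulP.
exists [seq (u.1, a * u.2) | u <- s].
  by move=> _ /mapP[u /sI[Iu Ju] ->]; split=> //; apply: IHn.
by rewrite big_map mulr_sumr; apply: eq_bigr => u _; rewrite mulrCA.
Qed.

Lemma ideal_expS (I : zmodClosed R) n x :
  x \in ideal_exp I n.+1 -> x \in ideal_exp I n.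
Proof.
case/ideal_mulP=> s sI ->; rewrite big_seq rpred_sum // => u /sI[_].
exact: ideal_expM.
Qed.

Lemma ideal_exp1 (I : zmodClosed R) x :
  (forall a y, y \in I -> a * y \in I) -> (x \in ideal_exp I 1) = (x \in I).
Proof.
move=> idI; apply/idP/idP => [/ideal_mulP[s sI ->]|Ix].
  by rewrite big_seq rpred_sum // => u /sI[Iu _]; rewrite mulrC idI.
by rewrite -[x]mulr1 mem_ideal_mul.
Qed.

End IdealPowers.

Section Subquotient.
Variables (V : zmodType) (I J : zmodClosed V).

Record zsub := Zsub { zsub_val :> V; zsub_valP : zsub_val \in I }.

HB.instance Definition _ := [isSub for zsub_val].
HB.instance Definition _ := [Choice of zsub by <:].
HB.instance Definition _ := [SubChoice_isSubZmodule of zsub by <:].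

Definition zsub_pred : {pred zsub} := fun x => val x \in J.

Lemma zsub_pred_closed : zmod_closed zsub_pred.
Proof.
have inE x : (x \in zsub_pred) = (val x \in J) by [].
split=> [|x y]; rewrite !inE; first by rewrite raddf0 rpred0.
by rewrite raddfB; apply: rpredB.
Qed.

HB.instance Definition _ :=
  GRing.isZmodClosed.Build zsub zsub_pred zsub_pred_closed.

(* I / (I :&: J), that is I / J when J is contained in I. *)
Definition subquotient : zmodType := Quotient.quot zsub_pred.

End Subquotient.

Definition zmod_isomorphic (U V : zmodType) : Prop :=
  exists f : {additive U -> V}, bijective f.

(* The library's actions are right actions: x acted on by a * b is
   (x acted on by a) acted on by b.  Composing with inversion turns them into
   left actions, with the same isomorphisms, sums, products and fixed points. *)
Record gset (gT : finGroupType) (G : {group gT}) := Gset {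
  gset_sort :> finType;
  gset_act : action G gset_sort
}.

Section GSets.
Variables (gT : finGroupType) (G : {group gT}).
Implicit Types X Y Z : gset G.

Definition gset_iso X Y := exists2 f : X -> Y, bijective f &
  forall a, a \in G -> forall x, f (gset_act X x a) = gset_act Y (f x) a.

Lemma gset_iso_refl X : gset_iso X X.
Proof. by exists id => //; exists id. Qed.

Lemma gset_iso_sym X Y : gset_iso X Y -> gset_iso Y X.
Proof.
case=> f [g fK gK] fE; exists g; first by exists f.
by move=> a Ga y; rewrite -{1}[y]gK -fE ?fK.
Qed.

Lemma gset_iso_trans Y X Z : gset_iso X Y -> gset_iso Y Z -> gset_iso X Z.
Proof.
case=> f bf fE [g bg gE]; exists (g \o f); first exact: bij_comp.
by move=> a Ga x /=; rewrite fE ?gE.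
Qed.

Section Constructions.
Variables X Y : gset G.

Fact gset_trivial_is_action (T : finType) : is_action G (fun (x : T) (_ : gT) => x).
Proof. by split=> // a x y. Qed.

Definition gset_trivial (T : finType) := Gset (Action (gset_trivial_is_action T)).

Definition sum_act (u : X + Y) (a : gT) : X + Y :=
  match u with
  | inl x => inl (gset_act X x a)
  | inr y => inr (gset_act Y y a)
  end.

Fact sum_is_action : is_action G sum_act.
Proof.
split=> [a [x|y] [x'|y'] //= [] /act_inj-> //|[x|y] a b Ga Gb /=];
by rewrite actMin.
Qed.

Definition gset_sum : gset G := Gset (Action sum_is_action).

Definition prod_act (u : X * Y) (a : gT) : X * Y :=
  (gset_act X u.1 a, gset_act Y u.2 a).

Fact prod_is_action : is_action G prod_act.
Proof.
split=> [a [x y] [x' y'] /= [] /act_inj-> /act_inj-> //|[x y] a b Ga Gb /=].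
by rewrite /prod_act /= !actMin.
Qed.

Definition gset_prod : gset G := Gset (Action prod_is_action).

Definition transport_act (i : 'I_#|X|) (a : gT) : 'I_#|X| :=
  enum_rank (gset_act X (enum_val i) a).

Fact transport_is_action : is_action G transport_act.
Proof.
split=> [a i j /enum_rank_inj/act_inj/enum_val_inj //|i a b Ga Gb].
by rewrite /transport_act enum_rankK actMin.
Qed.

End Constructions.

Definition gset_fix X := afix (gset_act X) G.

(* Every finite G-set is isomorphic to one with carrier some 'I_n.  Classes are
   formed on these, since the type of all finite G-sets lives in a universe too
   large to carry the library's structures; [gset_class] below is nevertheless
   defined on all finite G-sets, and [gset_classP] is the expected property. *)
Definition ord_gset := {n : nat & action G 'I_n}.

HB.instance Definition _ := gen_eqMixin ord_gset.
HB.instance Definition _ := gen_choiceMixin ord_gset.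

Definition gset_of_ord (u : ord_gset) : gset G := Gset (tagged u).
Definition ord_of_gset X : ord_gset :=
  Tagged (fun n => action G 'I_n) (Action (transport_is_action X)).

Lemma ord_of_gset_iso X : gset_iso (gset_of_ord (ord_of_gset X)) X.
Proof.
exists (enum_val : 'I_#|X| -> X).
  by exists enum_rank; [exact: enum_valK | exact: enum_rankK].
by move=> a Ga i /=; rewrite /transport_act enum_rankK.
Qed.

Definition ord_gset_iso u v := `[< gset_iso (gset_of_ord u) (gset_of_ord v) >].

Lemma ord_gset_isoP u v :
  reflect (gset_iso (gset_of_ord u) (gset_of_ord v)) (ord_gset_iso u v).
Proof. exact: asboolP. Qed.

Lemma ord_gset_iso_refl : reflexive ord_gset_iso.
Proof. by move=> u; apply/ord_gset_isoP/gset_iso_refl. Qed.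

Lemma ord_gset_iso_sym : symmetric ord_gset_iso.
Proof. by move=> u v; apply/ord_gset_isoP/ord_gset_isoP; apply: gset_iso_sym. Qed.

Lemma ord_gset_iso_trans : transitive ord_gset_iso.
Proof.
move=> v u w /ord_gset_isoP uv /ord_gset_isoP vw.
exact/ord_gset_isoP/(gset_iso_trans uv).
Qed.

Canonical ord_gset_equiv :=
  EquivRel ord_gset_iso ord_gset_iso_refl ord_gset_iso_sym ord_gset_iso_trans.

Definition gset_classes := {eq_quot ord_gset_iso}.

HB.instance Definition _ := Choice.on gset_classes.
HB.instance Definition _ : EqQuotient _ ord_gset_iso gset_classes :=
  EqQuotient.on gset_classes.

Definition gset_class X : gset_classes := \pi_gset_classes (ord_of_gset X).

Lemma gset_classP X Y : gset_class X = gset_class Y <-> gset_iso X Y.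
Proof.
have [hX hY] := (ord_of_gset_iso X, ord_of_gset_iso Y).
split=> [/eqquotP/ord_gset_isoP e | e].
  exact: gset_iso_trans (gset_iso_sym hX) (gset_iso_trans e hY).
apply/eqquotP/ord_gset_isoP.
exact: gset_iso_trans hX (gset_iso_trans e (gset_iso_sym hY)).
Qed.

Definition gset_repr (c : gset_classes) : gset G := gset_of_ord (repr c).

Lemma gset_reprK c : gset_class (gset_repr c) = c.
Proof.
rewrite -[RHS]reprK; apply/eqquotP/ord_gset_isoP; exact: ord_of_gset_iso.
Qed.

Lemma gset_class_repr X : gset_iso (gset_repr (gset_class X)) X.
Proof. by apply/gset_classP; rewrite gset_reprK. Qed.

Lemma gset_class_ind (P : gset_classes -> Prop) :
  (forall X, P (gset_class X)) -> forall c, P c.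
Proof. by move=> h c; rewrite -[c]gset_reprK. Qed.

Definition gset_class_zero := gset_class (gset_trivial void).
Definition gset_class_one := gset_class (gset_trivial unit).
Definition gset_class_add c d :=
  gset_class (gset_sum (gset_repr c) (gset_repr d)).
Definition gset_class_mul c d :=
  gset_class (gset_prod (gset_repr c) (gset_repr d)).

Lemma gset_sum_iso X X' Y Y' :
  gset_iso X X' -> gset_iso Y Y' -> gset_iso (gset_sum X Y) (gset_sum X' Y').
Proof.
case=> f [f' fK f'K] fE [g [g' gK g'K] gE].
exists (fun u : X + Y => match u with inl x => inl (f x) | inr y => inr (g y) end
  : X' + Y'); last by move=> a Ga [x|y] /=; rewrite ?fE ?gE.
exists (fun u : X' + Y' =>
  match u with inl x => inl (f' x) | inr y => inr (g' y) end : X + Y).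
  by case=> [x|y]; rewrite ?fK ?gK.
by case=> [x|y]; rewrite ?f'K ?g'K.
Qed.

Lemma gset_prod_iso X X' Y Y' :
  gset_iso X X' -> gset_iso Y Y' -> gset_iso (gset_prod X Y) (gset_prod X' Y').
Proof.
case=> f [f' fK f'K] fE [g [g' gK g'K] gE].
exists (fun u : X * Y => (f u.1, g u.2) : X' * Y').
  exists (fun u : X' * Y' => (f' u.1, g' u.2) : X * Y) => -[x y] /=.
    by rewrite fK gK.
  by rewrite f'K g'K.
by move=> a Ga [x y] /=; rewrite /prod_act /= fE ?gE.
Qed.

Lemma gset_class_addE X Y :
  gset_class_add (gset_class X) (gset_class Y) = gset_class (gset_sum X Y).
Proof. by apply/gset_classP/gset_sum_iso; apply: gset_class_repr. Qed.

Lemma gset_class_mulE X Y :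
  gset_class_mul (gset_class X) (gset_class Y) = gset_class (gset_prod X Y).
Proof. by apply/gset_classP/gset_prod_iso; apply: gset_class_repr. Qed.

Definition gset_classE := (gset_class_addE, gset_class_mulE).

Lemma gset_class_addA : associative gset_class_add.
Proof.
elim/gset_class_ind=> X; elim/gset_class_ind=> Y; elim/gset_class_ind=> Z.
rewrite !gset_classE; apply/gset_classP.
exists (fun u : X + (Y + Z) => match u with
  | inl x => inl (inl x) | inr (inl y) => inl (inr y) | inr (inr z) => inr z
  end : (X + Y) + Z); last by move=> a Ga [|[]].
by exists (fun u : (X + Y) + Z => match u with
  | inl (inl x) => inl x | inl (inr y) => inr (inl y) | inr z => inr (inr z)
  end : X + (Y + Z)); [case=> [|[]] | case=> [[]|]].
Qed.

Lemma gset_class_addC : commutative gset_class_add.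
Proof.
elim/gset_class_ind=> X; elim/gset_class_ind=> Y.
rewrite !gset_classE; apply/gset_classP.
exists (fun u : X + Y => match u with inl x => inr x | inr y => inl y end : Y + X);
  last by move=> a Ga [].
by exists (fun u : Y + X => match u with inl x => inr x | inr y => inl y end : X + Y);
  case.
Qed.

Lemma gset_class_add0 : left_id gset_class_zero gset_class_add.
Proof.
elim/gset_class_ind=> X; rewrite !gset_classE; apply/gset_classP.
exists (fun u : void + X => match u with inl v => of_void X v | inr x => x end);
  last by move=> a Ga [[]|].
by exists (fun x : X => inr x : void + X); first case=> [[]|].
Qed.

HB.instance Definition _ := GRing.isNmodule.Build gset_classes
  gset_class_addA gset_class_addC gset_class_add0.

Lemma gset_class_mulA : associative gset_class_mul.
Proof.
elim/gset_class_ind=> X; elim/gset_class_ind=> Y; elim/gset_class_ind=> Z.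
rewrite !gset_classE; apply/gset_classP.
exists (fun u : X * (Y * Z) => (u.1, u.2.1, u.2.2) : X * Y * Z) => //.
by exists (fun u : X * Y * Z => (u.1.1, (u.1.2, u.2)) : X * (Y * Z));
  [case=> [? []] | case=> [[]]].
Qed.

Lemma gset_class_mulC : commutative gset_class_mul.
Proof.
elim/gset_class_ind=> X; elim/gset_class_ind=> Y.
rewrite !gset_classE; apply/gset_classP.
exists (fun u : X * Y => (u.2, u.1) : Y * X) => //.
by exists (fun u : Y * X => (u.2, u.1) : X * Y); case.
Qed.

Lemma gset_class_mul1 : left_id gset_class_one gset_class_mul.
Proof.
elim/gset_class_ind=> X; rewrite !gset_classE; apply/gset_classP.
exists (fun u : unit * X => u.2) => //.
by exists (fun x : X => (tt, x) : unit * X); first by case=> [[]].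
Qed.

Lemma gset_class_mulDl : left_distributive gset_class_mul gset_class_add.
Proof.
elim/gset_class_ind=> X; elim/gset_class_ind=> Y; elim/gset_class_ind=> Z.
rewrite !gset_classE; apply/gset_classP.
exists (fun u : (X + Y) * Z => match u.1 with
  | inl x => inl (x, u.2) | inr y => inr (y, u.2)
  end : X * Z + Y * Z); last by move=> a Ga [[x|y] z].
by exists (fun u : X * Z + Y * Z => match u with
  | inl v => (inl v.1, v.2) | inr v => (inr v.1, v.2)
  end : (X + Y) * Z); [case=> [[]] | case=> [[]|[]]].
Qed.

Lemma gset_class_mul0 : left_zero gset_class_zero gset_class_mul.
Proof.
elim/gset_class_ind=> X; rewrite !gset_classE; apply/gset_classP.
exists (fun u : void * X => u.1); last by move=> a Ga [[]].
by exists (fun v : void => of_void (void * X) v); [case=> [[]] | case].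
Qed.

HB.instance Definition _ := GRing.Nmodule_isComPzSemiRing.Build gset_classes
  gset_class_mulA gset_class_mulC gset_class_mul1 gset_class_mulDl
  gset_class_mul0.

Lemma gset_classD X Y :
  gset_class (gset_sum X Y) = gset_class X + gset_class Y.
Proof. by rewrite -gset_class_addE. Qed.

Lemma gset_classM X Y :
  gset_class (gset_prod X Y) = gset_class X * gset_class Y.
Proof. by rewrite -gset_class_mulE. Qed.

Lemma gset_fixP X x :
  reflect (forall a, a \in G -> gset_act X x a = x) (x \in gset_fix X).
Proof. exact: afixP. Qed.

Lemma gset_iso_fix X Y : gset_iso X Y -> #|gset_fix X| = #|gset_fix Y|.
Proof.
case=> f bf fE; have fI := bij_inj bf.
rewrite -(card_imset _ fI); apply: eq_card => y; apply/imsetP/idP.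
  case=> x /gset_fixP xG ->; apply/gset_fixP => a Ga.
  by rewrite -fE ?xG.
case: bf => g fK gK /gset_fixP yG; exists (g y); last by rewrite gK.
by apply/gset_fixP => a Ga; apply: fI; rewrite fE // gK yG.
Qed.

Definition fix_mark (c : gset_classes) : int := #|gset_fix (gset_repr c)|%:Z.

Lemma fix_markE X : fix_mark (gset_class X) = #|gset_fix X|%:Z.
Proof. by rewrite /fix_mark (gset_iso_fix (gset_class_repr X)). Qed.

Lemma fix_mark_is_nmod_morphism : nmod_morphism fix_mark.
Proof.
split.
  rewrite fix_markE; apply/eqP.
  by rewrite eqz_nat -leqn0 (leq_trans (max_card _)) // card_void.
elim/gset_class_ind=> X; elim/gset_class_ind=> Y.
rewrite -gset_classD !fix_markE -PoszD; congr Posz.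
rewrite -(card_imset (gset_fix X) (@inl_inj X Y)).
rewrite -(card_imset (gset_fix Y) (@inr_inj X Y)) -cardsUI.
rewrite [X in (_ + X)%N](_ : _ = 0%N) ?addn0; last first.
  apply/eqP; rewrite cards_eq0 -subset0; apply/subsetP => u.
  by move=> /setIP[/imsetP[x _ ->] /imsetP[]].
apply: eq_card => u; apply/gset_fixP/setUP; last first.
  by case=> /imsetP[x /gset_fixP xG ->] a Ga /=; rewrite xG.
move=> uG.
case: u uG => [x|y] uG; [left | right]; apply/imsetP.
  by exists x => //; apply/gset_fixP => a /uG [].
by exists y => //; apply/gset_fixP => a /uG [].
Qed.

Lemma fix_mark_is_monoid_morphism : monoid_morphism fix_mark.
Proof.
split.
  rewrite fix_markE (_ : gset_fix _ = setT) ?cardsT ?card_unit //.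
  by apply/setP=> x; rewrite in_setT; apply/gset_fixP.
elim/gset_class_ind=> X; elim/gset_class_ind=> Y.
rewrite -gset_classM !fix_markE -PoszM -cardsX; congr Posz.
apply: eq_card => -[x y]; rewrite in_setX; apply/gset_fixP/andP.
  by move=> uG; split; apply/gset_fixP => a /uG [].
by case=> /gset_fixP xG /gset_fixP yG a Ga /=; rewrite /prod_act /= xG ?yG.
Qed.

HB.instance Definition _ := GRing.isNmodMorphism.Build gset_classes int
  fix_mark fix_mark_is_nmod_morphism.
HB.instance Definition _ := GRing.isMonoidMorphism.Build gset_classes int
  fix_mark fix_mark_is_monoid_morphism.

Definition burnside := gcompletion gset_classes.

HB.instance Definition _ := GRing.ComPzRing.on burnside.

Definition burnside_class X : burnside := gc_inj (gset_class X).

Definition augmentation : burnside -> int := gc_lift fix_mark.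

HB.instance Definition _ :=
  GRing.RMorphism.copy augmentation (gc_lift fix_mark).

Lemma augmentationE X : augmentation (burnside_class X) = #|gset_fix X|%:Z.
Proof. exact: etrans (gc_lift_inj _ _) (fix_markE X). Qed.

Lemma burnside_oner_neq0 : (1 : burnside) != 0.
Proof.
apply/eqP => /(congr1 augmentation).
by rewrite rmorph1 rmorph0.
Qed.

HB.instance Definition _ :=
  GRing.PzSemiRing_isNonZero.Build burnside burnside_oner_neq0.

Definition augmentation_ideal : {pred burnside} := fun x => augmentation x == 0.

Lemma mem_augmentation_ideal x :
  (x \in augmentation_ideal) = (augmentation x == 0).
Proof. by []. Qed.

Lemma augmentation_ideal_closed : zmod_closed augmentation_ideal.
Proof.
split=> [|x y]; rewrite !mem_augmentation_ideal ?rmorph0 //.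
by move=> /eqP x0 /eqP y0; rewrite rmorphB /= x0 y0 subr0.
Qed.

HB.instance Definition _ :=
  GRing.isZmodClosed.Build burnside augmentation_ideal augmentation_ideal_closed.

Lemma augmentation_idealM a x :
  x \in augmentation_ideal -> a * x \in augmentation_ideal.
Proof.
by rewrite !mem_augmentation_ideal rmorphM /= => /eqP->; rewrite mulr0.
Qed.

Definition augmentation_power n : zmodClosed burnside :=
  ideal_exp augmentation_ideal n.

Definition augmentation_quotient n : zmodType :=
  subquotient (augmentation_power n) (augmentation_power n.+1).

End GSets.

(* Main.v *)
From HB Require Import structures.
Require Import Defs.
From mathcomp Require Import all_boot all_order all_algebra all_fingroup.
From mathcomp Require Import all_solvable boolp.

Set Implicit Arguments.
Unset Strict Implicit.
Unset Printing Implicit Defensive.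

Import generic_quotient GRing.Theory Num.Theory.

(** Write [e_K] for the class in the Burnside ring of [H] of the transitive set
    of cosets of [K].  The augmentation ideal [D] is free on the [e_K], one for
    each conjugacy class of proper subgroups [K] ([burnside_decomposition]); the
    coordinates of an element count orbits according to their stabilizers.  If
    [L] is normal, all orbits of a product of coset spaces look alike and
    [e_K e_L = |H : KL| e_(K :&: L)] ([coset_class_mul]).

    The modular group [H] is generated by [x] of order [p ^ m] and [y] of order
    [p]; its centre and its Frattini subgroup [Phi] are both [<x ^ p>], and all
    its subgroups are normal except the conjugates of [<y>].  Three facts on
    products determine all the powers of [D].
    - A maximal subgroup [M] containing [K] satisfies [e_M e_K = p e_K], so [p D]
      is contained in [D ^ 2].
    - If [K] is contained in [Phi], then [K = <x> :&: L] for some proper [L] with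
      [<x> L = H], so [e_K = e_<x> e_L] lies in [D ^ 2].  Moreover [K L] is never
      [H] for [L] proper, so [e_K D] lies in the span of the [p e_J] with [J]
      contained in [Phi].
    - In a product [e_K e_L], the coordinate at a [J] not contained in [Phi] is
      divisible by [p]: when [K L = H], the intersection lies in [Phi] because
      [H / Phi] is [C_p x C_p] ([cap_sub_Phi]), and otherwise [p] divides
      [|H : KL|].  The one product of two nonnormal subgroups, the square of
      [e_<y>], is treated by counting points.
    Consequently, for positive [n], [D ^ n] consists of the elements of [D] whose
    coordinates are divisible by [p ^ (n - 1)] outside [Phi], and by
    [p ^ (n - 2)], or by [1] when [n = 1], inside [Phi] ([mem_ideal_exp]).  Hence
    [D / D ^ 2] is an [F_p]-space with one dimension for each class of proper
    subgroups not contained in [Phi], and for [n >= 2] the quotient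
    [D ^ n / D ^ (n + 1)] has one dimension for each class of proper subgroups.

    It remains to list the classes.  There are [m] subgroups of [Phi].  The other
    proper subgroups are [<x>], the conjugates of [<y>], and for each [j] with
    [0 < j < m] exactly [p] subgroups that meet [<x>] in its subgroup of order
    [p ^ j] without lying in [<x>] ([rep_conj], [rep_inj]). *)

(** * Isomorphisms out of a subquotient *)

Section SubquotientIso.

Local Open Scope ring_scope.

Variables (V W : zmodType) (I J : zmodClosed V) (g : V -> W).
Hypothesis gB : {in I &, {morph g : x y / x - y}}.
Hypothesis g_onto : forall w, exists2 x, x \in I & g x = w.
Hypothesis g_ker : forall x, x \in I -> (g x == 0) = (x \in J).

Lemma subquotient_iso : zmod_isomorphic (subquotient I J) W.
Proof.
pose h (q : subquotient I J) : W := g (val (repr q)).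
have gE (x y : zsub I) : g (val x) = g (val y) <->
    x = y %[mod subquotient I J]%qT.
  have -> : (g (val x) = g (val y)) <-> (g (val (x - y)) == 0).
    rewrite raddfB gB ?zsub_valP // subr_eq0; by split=> [->|/eqP].
  rewrite g_ker ?zsub_valP //.
  have -> : (val (x - y) \in J) = (x - y \in zsub_pred (I := I) J) by [].
  by rewrite Quotient.idealrBE; split=> /eqP.
have hpi x : h (\pi_(subquotient I J)%qT x) = g (val x).
  by apply/gE; rewrite reprK.
have h_additive : zmod_morphism h.
  move=> q r; rewrite -[q]reprK -[r]reprK -raddfB !hpi raddfB.
  by rewrite gB ?zsub_valP.
pose hM := GRing.isZmodMorphism.Build _ _ h h_additive.
pose f : {additive subquotient I J -> W} := HB.pack h hM.
exists f; have fE q : f q = h q by [].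
have /choice[s sP] w : exists x : zsub I, g (val x) = w.
  by have [x Ix gx] := g_onto w; exists (Zsub Ix).
exists (fun w => \pi_(subquotient I J)%qT (s w)) => [q|w]; rewrite fE.
  by rewrite -[RHS]reprK; apply/gE; rewrite sP.
by rewrite hpi sP.
Qed.

End SubquotientIso.

(** * Powers of an ideal described by divisibility of coordinates *)

Section PowersOfIdeal.

Local Open Scope ring_scope.

(** In the application, [e] runs over the classes of the coset spaces of proper
    subgroups, and the deep indices are the subgroups of the Frattini subgroup. *)
Variables (p : nat) (R : comPzRingType) (I : zmodClosed R) (T : finType).
Variables (e : T -> R) (c : T -> {additive R -> int}) (deep : pred T).
Hypothesis p_prime : prime p.
Hypothesis idealI : forall a x, x \in I -> a * x \in I.
Hypothesis basis_in : forall t, e t \in I.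
Hypothesis coord_basis : forall s t, c s (e t) = (s == t)%:R.
Hypothesis span_basis : forall x, x \in I -> x = \sum_t e t *~ c t x.
Hypothesis mul_p : forall t, exists2 y, y \in I & y * e t = e t *+ p.
Hypothesis deep_sqr : forall t, deep t -> e t \in ideal_exp I 2.
Hypothesis shallow_mul : forall s t u, ~~ deep u -> (p %| c u (e s * e t))%Z.
Hypothesis deep_mul :
  forall s t, deep t -> exists k u, deep u /\ e s * e t = e u *+ (p * k).

(** The power of [p] that must divide coordinate [t] of an element of the
    [n.+1]-st power of [I].  A deep basis element already lies in the square, so
    it is one step ahead, except for [n = 0] where both weights are [0]. *)
Definition weight n t := if deep t then n.-1 else n.

Lemma mulp_ideal_exp a k t :
  e t \in ideal_exp I a -> e t *+ p ^ k \in ideal_exp I (a + k).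
Proof.
move=> et; elim: k => [|k IHk]; first by rewrite addn0.
have [y Iy ye] := mul_p t.
by rewrite expnS mulrnA -ye -mulrnAr addnS; apply: mem_ideal_mul.
Qed.

Lemma weight_ideal_exp n t : e t *+ p ^ weight n t \in ideal_exp I n.+1.
Proof.
have et1 : e t \in ideal_exp I 1 by rewrite ideal_exp1.
rewrite /weight; case: ifP => [gt|_]; last first.
  by rewrite -add1n; apply: mulp_ideal_exp.
by case: n => [|n] //; rewrite -add2n; apply/mulp_ideal_exp/deep_sqr.
Qed.

(** Multiplication by [e s] supplies the divisibility required one power further:
    a deep factor gains [p] by [deep_mul], and a shallow one has the larger
    weight [n] already, so that only the shallow coordinates of the product
    must gain a factor [p], which they do by [shallow_mul]. *)
Lemma weight_mul n s r t :
  ((p ^ weight n.+1 t)%N %| c t (e s * e r) * (p ^ weight n r)%N%:Z)%Z.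
Proof.
rewrite /weight; have [gr|br] := boolP (deep r).
  have [k [u [gu ->]]] := deep_mul s gr.
  rewrite raddfMn /= coord_basis; have [->|] := eqVneq t u; last first.
    by rewrite mul0rn mul0r dvdz0.
  rewrite gu -mulrnA mul1n natz -PoszM dvdzE /= mulnC mulnA -expnSr.
  by apply/dvdn_mulr/dvdn_exp2l/leqSpred.
have [gt|bt] := boolP (deep t); first exact/dvdz_mull/dvdzz.
by rewrite expnS PoszM dvdz_mul ?shallow_mul.
Qed.

Lemma mem_ideal_exp n x :
  reflect (x \in I /\ forall t, ((p ^ weight n t)%N %| c t x)%Z)
          (x \in ideal_exp I n.+1).
Proof.
apply: (iffP idP) => [|[Ix cx]]; last first.
  rewrite (span_basis Ix); apply: rpred_sum => t _.
  have /dvdzP[k ->] := cx t.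
  by rewrite mulrC mulrzA rpredMz ?weight_ideal_exp.
elim: n x => [|n IHn] x.
  by rewrite ideal_exp1 // => Ix; split=> // t; rewrite /weight if_same dvd1z.
case/ideal_mulP=> s sI ->; split=> [|t].
  by rewrite big_seq rpred_sum // => u /sI[Iu _]; rewrite mulrC idealI.
rewrite raddf_sum big_seq rpred_sum // => -[y z] /sI[/= Iy /IHn[Iz cz]].
rewrite (span_basis Iy) mulr_suml raddf_sum rpred_sum // => i _.
rewrite {1}(span_basis Iz) mulr_sumr raddf_sum rpred_sum // => j _.
have /dvdzP[k ->] := cz j.
rewrite mulrzAl mulrzAr !raddfMz -!mulrzA -mulrzr intz.
have -> : k * (p ^ weight n j)%N * c i y = (p ^ weight n j)%N%:Z * (k * c i y).
  by rewrite mulrCA mulrA.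
by rewrite [c t _ * _]mulrA; apply: dvdz_mulr; apply: weight_mul.
Qed.

(* The indices whose weight increases from one power of the ideal to the next;
   each of them contributes one dimension to the quotient. *)
Let P n := [pred t | weight n t < weight n.+1 t]%N.

Lemma ideal_quotient_iso n :
  zmod_isomorphic (subquotient (ideal_exp I n.+1) (ideal_exp I n.+2))
    'rV['F_p]_(if n == 0%N then #|[pred t | ~~ deep t]| else #|T|).
Proof.
have -> : (if n == 0%N then #|[pred t | ~~ deep t]| else #|T|) = #|P n|.
  case: n => [|n] /=; first by apply: eq_card => t; rewrite !inE /weight; case: (deep t).
  by apply: eq_card => t; rewrite !inE /weight; case: (deep t); rewrite ltnS leqnn.
have p_gt0 := prime_gt0 p_prime; have chF := pchar_Fp p_prime.
have pw_neq0 k : (p ^ k)%N%:Z != 0 by rewrite eqz_nat -lt0n expn_gt0 p_gt0.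
have weightS t : t \in P n -> weight n.+1 t = (weight n t).+1.
  by rewrite inE /weight; case: (deep t) => //; case: (n).
pose g x : 'rV['F_p]_#|P n| :=
  \row_i ((c (enum_val i) x %/ (p ^ weight n (enum_val i))%N)%Z)%:~R.
apply: (@subquotient_iso _ _ _ _ g) => [x y|w|x].
- case/mem_ideal_exp=> _ cx /mem_ideal_exp[_ cy]; apply/rowP=> i.
  rewrite !mxE raddfB /=.
  have /dvdzP[k ->] := cx (enum_val i); have /dvdzP[l ->] := cy (enum_val i).
  by rewrite -mulrBl !mulzK // rmorphB.
- exists (\sum_i e (enum_val i) *+ p ^ weight n (enum_val i) *+ (w 0 i : nat)).
    by apply: rpred_sum => i _; apply/rpredMn/weight_ideal_exp.
  apply/rowP=> i; rewrite mxE raddf_sum (bigD1 i) //= big1 => [|j ne_ji].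
    rewrite !raddfMn /= coord_basis eqxx addr0 -!mulrnA mul1n natz.
    by rewrite PoszM mulKz // -[LHS]/((w 0 i : nat)%:R) natr_Zp.
  by rewrite !raddfMn /= coord_basis (inj_eq enum_val_inj) eq_sym (negPf ne_ji) !mul0rn.
case/mem_ideal_exp=> Ix cx; apply/eqP/mem_ideal_exp => [gx0|[_ cx']].
  split=> // t; have [Pt|] := boolP (t \in P n); last first.
    rewrite inE -leqNgt => le_w; apply: dvdz_trans (cx t).
    by rewrite dvdzE /= dvdn_exp2l.
  have /rowP/(_ (enum_rank_in Pt t)) := gx0.
  rewrite !mxE enum_rankK_in // => /eqP; rewrite -(dvdz_pcharf chF).
  have /dvdzP[k ->] := cx t; rewrite mulzK // => pk.
  by rewrite weightS // expnS PoszM dvdz_mul.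
apply/rowP=> i; rewrite !mxE; apply/eqP; rewrite -(dvdz_pcharf chF).
have /dvdzP[k ->] := cx' (enum_val i).
by rewrite weightS ?enum_valP // expnS PoszM mulrA mulzK // dvdz_mull.
Qed.

End PowersOfIdeal.

(** * Additive maps out of a group completion *)

(** Counting the points with a given stabilizer is additive on disjoint unions
    but not multiplicative, so it extends to the Burnside ring by the universal
    property of the additive group alone. *)
Section AdditiveLift.

Local Open Scope ring_scope.

Variables (S : comPzSemiRingType) (V : zmodType) (f : {additive S -> V}).

Definition gc_additive_lift (q : gcompletion S) : V :=
  f (repr q).1 - f (repr q).2.

Lemma gc_additive_liftE x y : gc_additive_lift (gc_pair x y) = f x - f y.
Proof.
have [z e] := gc_reprP x y; rewrite /gc_additive_lift.
move: (repr _) e => [x1 y1] /= /(congr1 f); rewrite !raddfD => /addIr e.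
by apply/eqP; rewrite subr_eq addrAC -e addrK.
Qed.

Lemma gc_additive_lift_is_zmod_morphism : zmod_morphism gc_additive_lift.
Proof.
elim/gc_ind=> x y; elim/gc_ind=> z t.
by rewrite gc_pairB !gc_additive_liftE !(raddfD f) opprB opprD addrACA.
Qed.

HB.instance Definition _ := GRing.isZmodMorphism.Build (gcompletion S) V
  gc_additive_lift gc_additive_lift_is_zmod_morphism.

Lemma gc_additive_lift_inj x : gc_additive_lift (gc_inj x) = f x.
Proof. by rewrite gc_additive_liftE raddf0 subr0. Qed.

End AdditiveLift.

(** * Stabilizers and orbits *)

Section Stabilizers.

Local Open Scope ring_scope.

Variables (gT : finGroupType) (G : {group gT}).
Implicit Types (X Y : gset G) (K L J : {group gT}).

Definition stab X x := 'C[x | gset_act X]%G.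
Arguments stab X x : clear implicits.

Lemma stabP X x a :
  reflect (a \in G /\ gset_act X x a = x) (a \in stab X x).
Proof.
rewrite !inE sub1set inE.
by apply: (iffP andP) => -[Ga /eqP].
Qed.

Lemma stab_sub X x : stab X x \subset G.
Proof. by apply/subsetP=> a /stabP[]. Qed.

Lemma stab_act X x a : a \in G -> stab X (gset_act X x a) = (stab X x :^ a)%G.
Proof. by move=> Ga; apply/val_inj/astab1_act_in. Qed.

Lemma stab_iso X Y (f : X -> Y) x : injective f ->
    (forall a, a \in G -> forall x, f (gset_act X x a) = gset_act Y (f x) a) ->
  stab Y (f x) = stab X x.
Proof.
move=> fI fE; apply/group_inj/setP=> a.
apply/stabP/stabP=> -[Ga ax]; split=> //; last by rewrite -fE ?ax.
by apply: fI; rewrite fE.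
Qed.

Lemma stab_prod X Y x y :
  stab (gset_prod X Y) (x, y) = (stab X x :&: stab Y y)%G.
Proof.
apply/group_inj/setP=> a; rewrite [RHS]in_setI.
apply/stabP/andP=> [[Ga [ax ay]]|[/stabP[Ga ax] /stabP[_ ay]]].
  by split; apply/stabP.
by split=> //=; rewrite /prod_act /= ax ay.
Qed.

Lemma stab_inl X Y x : stab (gset_sum X Y) (inl x) = stab X x.
Proof. by rewrite -(@stab_iso X (gset_sum X Y) inl) // => ? ? []. Qed.

Lemma stab_inr X Y y : stab (gset_sum X Y) (inr y) = stab Y y.
Proof. by rewrite -(@stab_iso Y (gset_sum X Y) inr) // => ? ? []. Qed.

Definition transitive_from X x := forall y : X, exists2 a, a \in G & y = gset_act X x a.
Arguments transitive_from X x : clear implicits.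

(** The map sends [x a] to [y a]; the inclusion of stabilizers makes the value
    independent of the choice of [a]. *)
Lemma equivariant_extension X Y x y : transitive_from X x ->
    stab X x \subset stab Y y ->
  exists f : X -> Y, forall a, a \in G -> f (gset_act X x a) = gset_act Y y a.
Proof.
move=> trX /subsetP sxy.
have /choice[g gP] z : exists a, a \in G /\ z = gset_act X x a.
  by have [a] := trX z; exists a.
exists (fun z => gset_act Y y (g z)) => a Ga.
have [Gg e] := gP (gset_act X x a); set b := g _ in Gg e *.
have : (a * b^-1)%g \in stab X x.
  by apply/stabP; rewrite groupM ?groupV // actMin ?groupV // e actKin.
case/sxy/stabP=> _ e'; rewrite -[in LHS]e' -actMin ?groupM ?groupV //.
by rewrite mulgKV.
Qed.

Lemma transitive_iso X Y x y : transitive_from X x ->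
  transitive_from Y y -> stab X x = stab Y y -> gset_iso X Y.
Proof.
move=> trX trY sxy.
have [|f fE] := @equivariant_extension X Y x y trX; first by rewrite sxy.
have [|g gE] := @equivariant_extension Y X y x trY; first by rewrite sxy.
exists f => [|a Ga z].
  exists g => [z|z]; [have [a Ga ->] := trX z | have [a Ga ->] := trY z].
    by rewrite fE ?gE.
  by rewrite gE ?fE.
by have [b Gb ->] := trX z; rewrite -actMin ?fE ?groupM // actMin.
Qed.

Section SubGset.
Variables (X : gset G) (A : {set X}).
Hypothesis closedA : forall a x, a \in G -> x \in A -> gset_act X x a \in A.

(** Elements outside [G] act trivially: an action has to be injective for every
    element of the ambient group, not only for those of its domain. *)
Definition sub_act (u : {x | x \in A}) (a : gT) : {x | x \in A} :=
  if a \in G then insubd u (gset_act X (val u) a) else u.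

Lemma val_sub_act u a : a \in G -> val (sub_act u a) = gset_act X (val u) a.
Proof. by move=> Ga; rewrite /sub_act Ga val_insubd closedA ?(valP u). Qed.

Fact sub_is_action : is_action G sub_act.
Proof.
split=> [a u v|u a b Ga Gb]; last first.
  by apply: val_inj; rewrite !val_sub_act ?groupM // actMin.
have [Ga|nGa] := boolP (a \in G); last by rewrite /sub_act (negPf nGa).
by move=> /(congr1 val); rewrite !val_sub_act // => /act_inj/val_inj.
Qed.

Definition gset_sub : gset G := Gset (Action sub_is_action).

Lemma stab_gset_sub u : stab gset_sub u = stab X (val u).
Proof.
apply/group_inj/setP=> a; apply/stabP/stabP=> -[Ga] /=.
  by move=> /(congr1 val); rewrite val_sub_act.
by move=> au; split=> //; apply: val_inj; rewrite val_sub_act.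
Qed.

End SubGset.

Lemma orbit_closed X x a y : a \in G ->
  y \in orbit (gset_act X) G x -> gset_act X y a \in orbit (gset_act X) G x.
Proof. by move=> Ga /imsetP[b Gb ->]; rewrite -actMin // mem_orbit ?groupM. Qed.

Lemma orbitC_closed X x a y : a \in G ->
  y \in ~: orbit (gset_act X) G x -> gset_act X y a \in ~: orbit (gset_act X) G x.
Proof.
move=> Ga; rewrite !inE; apply: contra => /(orbit_closed (groupVr Ga)).
by rewrite actKin.
Qed.

Definition gset_orbit X x := gset_sub (@orbit_closed X x).
Arguments gset_orbit X x : clear implicits.

Definition gset_orbit_pt X x : gset_orbit X x := exist _ x (orbit_refl _ _ _).
Arguments gset_orbit_pt X x : clear implicits.

Lemma gset_orbit_transitive X x : transitive_from _ (gset_orbit_pt X x).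
Proof.
move=> z; have /imsetP[a Ga za] := valP z; exists a => //.
by apply/val_inj/(etrans za); rewrite [RHS](val_sub_act (@orbit_closed X x)).
Qed.

Lemma orbit_decomposition X x :
  gset_iso (gset_sum (gset_orbit X x) (gset_sub (@orbitC_closed X x))) X.
Proof.
set A := orbit _ _ _.
pose f (u : {y | y \in A} + {y | y \in ~: A}) : X :=
  match u with inl y => val y | inr y => val y end.
have fI : injective f.
  case=> [[y Ay]|[y Ay]] [[z Az]|[z Az]] /= e; have := Az; rewrite -{1}e.
  - by move=> _; congr inl; apply: val_inj.
  - by rewrite inE Ay.
  - by move=> Ay'; have := Ay; rewrite inE Ay'.
  by move=> _; congr inr; apply: val_inj.
have f_onto y : exists u, f u = y.
  have [Ay|Ay] := boolP (y \in A); first by exists (inl (exist _ y Ay)).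
  by rewrite -in_setC in Ay; exists (inr (exist _ y Ay)).
have /choice[g gK] := f_onto.
exists f; first by exists g => // u; apply: fI; rewrite gK.
move=> a Ga [u|u] /=; rewrite val_sub_act //.
  exact: orbit_closed.
exact: orbitC_closed.
Qed.

(** * Coset spaces and orbit coordinates *)

(** [G] acts by right translation on all subsets of the ambient group, and the
    orbit of a subgroup [K] of [G] is the space of right cosets of [K] in [G]. *)
Definition translations : gset G := Gset ('Rs \ subsetT G)%act.

Definition coset_gset K := gset_orbit translations (K : {set gT}).

Definition coset_pt K : coset_gset K := gset_orbit_pt translations K.

Definition coset_class K : burnside G := burnside_class (coset_gset K).

Lemma coset_pt_transitive K : transitive_from _ (coset_pt K).
Proof. exact: (@gset_orbit_transitive translations). Qed.

Lemma stab_coset_pt K : K \subset G -> stab (coset_gset K) (coset_pt K) = K.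
Proof.
move=> sKG; rewrite stab_gset_sub; apply/group_inj/setP=> a.
change (val _) with (K : {set gT}).
apply/stabP/idP=> [[_ Ka]|Ka].
  by have := rcoset_refl K a; rewrite -rcosetE [rcoset _ _]Ka.
by split; [apply: (subsetP sKG) | rewrite -[LHS]/(rcoset K a) rcosetE rcoset_id].
Qed.

Lemma astab_coset_pt K : K \subset G -> 'C[coset_pt K | gset_act (coset_gset K)]%g = K.
Proof. by move=> sKG; rewrite -[in RHS](stab_coset_pt sKG). Qed.

Lemma burnside_iso X Y : gset_iso X Y -> burnside_class X = burnside_class Y.
Proof. by move=> /gset_classP e; rewrite /burnside_class e. Qed.

Lemma burnside_classD X Y :
  burnside_class (gset_sum X Y) = burnside_class X + burnside_class Y.
Proof. by rewrite /burnside_class gset_classD raddfD. Qed.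

Lemma burnside_classM X Y :
  burnside_class (gset_prod X Y) = burnside_class X * burnside_class Y.
Proof. by rewrite /burnside_class gset_classM rmorphM. Qed.

Lemma transitive_class X x :
  transitive_from X x -> burnside_class X = coset_class (stab X x).
Proof.
move=> trX; apply: burnside_iso.
apply: transitive_iso trX (@coset_pt_transitive (stab X x)) _.
by rewrite stab_coset_pt ?stab_sub.
Qed.

Lemma coset_class_conj K a :
  K \subset G -> a \in G -> coset_class (K :^ a)%G = coset_class K.
Proof.
move=> sKG Ga; pose x := gset_act _ (coset_pt K) a.
rewrite [RHS](@transitive_class _ x) ?stab_act ?stab_coset_pt // => z.
have [b Gb ->] := coset_pt_transitive z; exists (a^-1 * b)%g.
  by rewrite groupM ?groupV.
by rewrite actMin ?groupV // actKin.
Qed.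

Lemma stab_coset K x : K \subset G ->
  exists2 a, a \in G & stab (coset_gset K) x = (K :^ a)%G.
Proof.
move=> sKG; have [a Ga ->] := coset_pt_transitive x.
by exists a; rewrite // stab_act // stab_coset_pt.
Qed.

(** A finite [G]-set is the disjoint union of its orbits, each of them isomorphic
    to the coset space of a stabilizer. *)
Lemma burnside_class_ind (P : burnside G -> Prop) X :
    P 0 -> (forall u v, P u -> P v -> P (u + v)) ->
  (forall x : X, P (coset_class (stab X x))) -> P (burnside_class X).
Proof.
move=> P0 PD; have [n] := ubnP #|X|; elim: n X => // n IHn X leXn PX.
have [x _|X0] := pickP (fun _ : X => true); last first.
  suff -> : burnside_class X = 0 by [].
  rewrite /burnside_class (_ : gset_class X = 0) ?raddf0 //; apply/gset_classP.
  have F (x : X) : False by have := X0 x.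
  exists (fun x : X => match F x return void with end); last by move=> a _ x; case: (F x).
  by exists (of_void X) => [x|[]]; case: (F x).
rewrite -(burnside_iso (orbit_decomposition x)) burnside_classD.
have xo : x \in orbit (gset_act X) G x := orbit_refl _ _ _.
apply: PD.
  by rewrite (transitive_class (@gset_orbit_transitive X x)) stab_gset_sub.
apply: IHn => [|u]; last by rewrite stab_gset_sub.
rewrite card_sig -ltnS; apply: leq_trans leXn; rewrite ltnS.
by apply/proper_card/properP; split; [apply/subsetP | exists x; rewrite ?inE ?xo].
Qed.

Definition stab_count (Q : pred {group gT}) X := #|[set x : X | Q (stab X x)]|.

Lemma stab_count_iso Q X Y : gset_iso X Y -> stab_count Q X = stab_count Q Y.
Proof.
case=> f bf fE; have fI := bij_inj bf; rewrite /stab_count -(card_imset _ fI).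
apply: eq_card => y; have [g fK gK] := bf.
rewrite inE; apply/imsetP/idP => [[x Qx ->]|Qy].
  by move: Qx; rewrite inE (stab_iso x fI fE).
by exists (g y); rewrite ?gK // inE -(stab_iso (g y) fI fE) gK.
Qed.

Definition class_count Q (c : gset_classes G) : int :=
  (stab_count Q (gset_repr c))%:Z.

Lemma class_countE Q X : class_count Q (gset_class X) = (stab_count Q X)%:Z.
Proof. by rewrite /class_count (stab_count_iso Q (gset_class_repr X)). Qed.

Lemma class_count_is_nmod_morphism Q : nmod_morphism (class_count Q).
Proof.
split.
  by rewrite [LHS](class_countE Q (gset_trivial G void)) /stab_count eq_card0 // => -[].
elim/gset_class_ind=> X; elim/gset_class_ind=> Y.
rewrite -gset_classD !class_countE /stab_count -!sum1dep_card big_sumType /=.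
by rewrite PoszD; congr (Posz _ + Posz _);
  apply: eq_bigl => x; rewrite ?stab_inl ?stab_inr.
Qed.

HB.instance Definition _ Q := GRing.isNmodMorphism.Build (gset_classes G) int
  (class_count Q) (class_count_is_nmod_morphism Q).

Definition point_count Q : burnside G -> int := gc_additive_lift (class_count Q).

HB.instance Definition _ Q :=
  GRing.isZmodMorphism.Build (burnside G) int (point_count Q)
    (gc_additive_lift_is_zmod_morphism (class_count Q)).

Lemma point_countE Q X : point_count Q (burnside_class X) = (stab_count Q X)%:Z.
Proof. by rewrite /point_count gc_additive_lift_inj /= class_countE. Qed.

Lemma burnside_ind (P : burnside G -> Prop) :
    P 0 -> (forall u v, P u -> P v -> P (u - v)) ->
  (forall K, K \subset G -> P (coset_class K)) -> forall u, P u.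
Proof.
move=> P0 PB PK.
have PD u v : P u -> P v -> P (u + v).
  by move=> Pu Pv; rewrite -[v]opprK; apply: (PB) => //; rewrite -sub0r; apply: PB.
have PX X : P (burnside_class X).
  by apply: burnside_class_ind => // x; apply/PK/stab_sub.
elim/gc_ind=> x y; rewrite gc_pairE; apply: (PB); [move: x|move: y];
  by elim/gset_class_ind=> X; apply: PX.
Qed.

(** The number of points of the coset space of [J] whose stabilizer is [J] itself,
    and not just a conjugate of [J]. *)
Definition self_count J : int := point_count (pred1 J) (coset_class J).

(** The points in question are the [J g] with [g] normalizing [J], that is, the
    orbit of the base point under the normalizer. *)
Lemma self_countE J : J \subset G -> self_count J = #|'N_G(J) : J|%g%:Z.
Proof.
move=> sJG; rewrite /self_count point_countE /stab_count; congr (Posz _).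
have sNG : 'N_G(J)%g \subset G := subsetIl _ _.
have sJN : J \subset 'N_G(J)%g by rewrite subsetI sJG normG.
have -> : #|'N_G(J) : J|%g = #|'N_G(J) : 'C_('N_G(J))[coset_pt J | gset_act _]|%g.
  by rewrite astab_coset_pt // (setIidPr sJN).
rewrite -card_orbit_in //; apply: eq_card => x; rewrite inE /=.
have [a Ga ->] := coset_pt_transitive x.
apply/eqP/imsetP=> [eJ|[b /setIP[Gb nJb] ->]].
  exists a => //; rewrite inE Ga /=; apply/normP.
  by rewrite -[RHS](congr1 (@gval _) eJ) stab_act // stab_coset_pt.
by apply: group_inj; rewrite stab_act // stab_coset_pt //; apply/normP.
Qed.

Lemma count_coset J K : J \subset G -> K \subset G ->
  point_count (pred1 J) (coset_class K) =
    self_count J *+ ((K : {set gT}) \in (J :^: G)%g).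
Proof.
move=> sJG sKG; case: imsetP => [[a Ga eKJ]|nKJ].
  have -> : K = (J :^ a)%G by apply: group_inj.
  by rewrite coset_class_conj.
rewrite point_countE /stab_count eq_card0 // => x; rewrite !inE.
have [a Ga ->] := stab_coset x sKG; apply/eqP=> eJK; case: nKJ.
by exists a^-1%g; rewrite ?groupV // -eJK /= conjsgK.
Qed.

Lemma self_count_gt0 J : J \subset G -> 0 < self_count J :> int.
Proof.
move=> sJG; rewrite /self_count point_countE /stab_count ltz_nat.
by apply/card_gt0P; exists (coset_pt J); rewrite inE /= stab_coset_pt.
Qed.

Lemma dvd_self_count J u :
  J \subset G -> (self_count J %| point_count (pred1 J) u)%Z.
Proof.
move=> sJG; elim/burnside_ind: u => [|u v Ju Jv|K sKG].
- by rewrite raddf0.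
- by rewrite raddfB rpredB.
by rewrite count_coset // rpredMn // dvdzz.
Qed.

(** On the class of a [G]-set this is the number of orbits whose stabilizers are
    conjugate to [J]: each such orbit has [self_count J] points with stabilizer
    [J], and the other orbits have none.  The division is exact on the whole
    Burnside ring by [dvd_self_count]. *)
Definition orbit_coord J u : int := (point_count (pred1 J) u %/ self_count J)%Z.

Section Coord.
Variable J : {group gT}.
Hypothesis sJG : J \subset G.

Lemma count_coord u : point_count (pred1 J) u = orbit_coord J u * self_count J.
Proof. by rewrite divzK ?dvd_self_count. Qed.

Let self_count_neq0 : self_count J != 0.
Proof. by rewrite lt0r_neq0 ?self_count_gt0. Qed.

Lemma coord_is_zmod_morphism : zmod_morphism (orbit_coord J).
Proof.
move=> u v; apply: (mulIf self_count_neq0).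
by rewrite mulrBl -!count_coord raddfB.
Qed.

HB.instance Definition _ :=
  GRing.isZmodMorphism.Build (burnside G) int (orbit_coord J) coord_is_zmod_morphism.

Definition coord_additive : {additive burnside G -> int} := orbit_coord J.

Lemma coord_coset K : K \subset G ->
  orbit_coord J (coset_class K) = ((K : {set gT}) \in (J :^: G)%g)%:R.
Proof.
move=> sKG; apply: (mulIf self_count_neq0).
by rewrite -count_coord count_coset //; case: (_ \in _); rewrite ?mul1r ?mul0r.
Qed.

End Coord.

(** * Products of coset spaces *)

(** A point [(J a, J b)] has stabilizer [J] only if both conjugates of [J] are
    equal to [J], so the points with stabilizer [J] number [self_count J ^ 2]. *)
Lemma coord_sqr J : J \subset G ->
  orbit_coord J (coset_class J * coset_class J) = #|'N_G(J) : J|%g%:Z.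
Proof.
move=> sJG; apply: (mulIf (lt0r_neq0 (self_count_gt0 sJG))).
rewrite -count_coord // -(self_countE sJG) -burnside_classM point_countE.
rewrite /self_count point_countE -PoszM /stab_count -cardsX; congr Posz.
apply: eq_card => -[x y]; rewrite in_setX !inE /= stab_prod.
have [a Ga ->] := stab_coset x sJG; have [b Gb ->] := stab_coset y sJG.
apply/eqP/andP=> [eJ|[/eqP-> /eqP->]]; last by apply: group_inj; apply: setIid.
have /setP/subset_eqP/andP[_] := congr1 (@gval _) eJ.
rewrite subsetI => /andP[sJa sJb].
by split; rewrite eq_sym -val_eqE eqEcard ?sJa ?sJb cardJg leqnn.
Qed.

Lemma coord_mul_eq0 J K L : K \subset G ->
    (forall a, a \in G -> ~~ (J \subset (K :^ a)%g)) ->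
  orbit_coord J (coset_class K * coset_class L) = 0.
Proof.
move=> sKG nJK; rewrite /orbit_coord -burnside_classM point_countE /stab_count.
rewrite eq_card0 ?div0z //.
move=> [x y]; rewrite !inE /= stab_prod.
have [a Ga ->] := stab_coset x sKG; apply: contraNF (nJK a Ga) => /eqP <-.
exact: subsetIl.
Qed.

Lemma count_all_coset K : K \subset G ->
  point_count predT (coset_class K) = #|G : K|%g%:Z.
Proof.
move=> sKG; rewrite point_countE; congr Posz.
have -> : #|G : K|%g = #|G : 'C_G[coset_pt K | gset_act _]|%g.
  by rewrite astab_coset_pt // (setIidPr sKG).
rewrite -card_orbit_in //; apply: eq_card => x; rewrite inE /=.
by have [a Ga ->] := coset_pt_transitive x; rewrite mem_orbit.
Qed.

(** Every stabilizer in the product is [(K :^ a) :&: L], a conjugate of [K :&: L]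
    as [L] is normal; the number of orbits follows by counting points. *)
Lemma coset_class_mul K L : K \subset G -> (L <| G)%g ->
  coset_class K * coset_class L = coset_class (K :&: L)%G *+ #|G : (K <*> L)|%g.
Proof.
move=> sKG nLG; have sLG := normal_sub nLG.
have sKLG : (K :&: L)%g \subset G by rewrite subIset ?sKG.
have [k ek] : exists k, coset_class K * coset_class L = coset_class (K :&: L)%G *+ k.
  rewrite -burnside_classM.
  apply: (burnside_class_ind (P := fun u => exists k, u = coset_class (K :&: L)%G *+ k)).
  - by exists 0%N.
  - by move=> u v [k ->] [l ->]; exists (k + l)%N; rewrite mulrnDr.
  move=> [x y]; exists 1%N; rewrite stab_prod.
  have [a Ga ->] := stab_coset x sKG; have [b Gb ->] := stab_coset y sLG.
  rewrite -(coset_class_conj (K := (K :&: L)%G) sKLG Ga); congr coset_class.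
  by apply: group_inj => /=; rewrite conjIg !(normsP (normal_norm nLG)).
rewrite ek; congr (_ *+ _).
have := congr1 (point_count predT) ek; rewrite raddfMn /= count_all_coset //.
have -> : point_count predT (coset_class K * coset_class L) = (#|G : K|%g * #|G : L|%g)%N%:Z.
  rewrite PoszM -!count_all_coset // -burnside_classM !point_countE -PoszM /stab_count.
  by rewrite -cardsX; congr Posz; apply: eq_card => -[x y]; rewrite in_setX !inE.
rewrite -mulr_natr natz -PoszM => -[] /eqP.
have sJG : (K <*> L)%g \subset G by rewrite join_subG sKG.
have KJ_K : #|K <*> L : L|%g = #|K : K :&: L|%g.
  apply/eqP; rewrite indexgI -(eqn_pmul2l (cardG_gt0 L)) LagrangeMl.
  rewrite Lagrange ?joing_subr //= joingC norm_joinEr //.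
  exact: subset_trans sKG (normal_norm nLG).
rewrite -(Lagrange_index sKG (subsetIl K L)) -(Lagrange_index sJG (joing_subr K L)).
by rewrite KJ_K -mulnA eqn_pmul2l // mulnC eqn_pmul2l // => /eqP->.
Qed.

Lemma coset_class_full : coset_class G = 1.
Proof.
have trt : transitive_from (gset_trivial G unit) tt by case; exists 1%g.
transitivity (burnside_class (gset_trivial G unit)); last by [].
rewrite (transitive_class trt).
congr coset_class; apply/group_inj/setP=> a.
by apply/idP/stabP => [|[]].
Qed.

Lemma augmentation_coset K : K \proper G -> augmentation (coset_class K) = 0.
Proof.
move=> /andP[sKG nsGK]; rewrite augmentationE eq_card0 // => x.
apply/negP=> /gset_fixP fx; case/negP: nsGK.
have [a Ga ex] := stab_coset x sKG.
suff: G \subset stab (coset_gset K) x by rewrite ex -{1}(conjGid Ga) conjSg.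
by apply/subsetP=> b Gb; apply/stabP; rewrite fx.
Qed.

(** * A basis of the augmentation ideal *)

(** The family [r] represents each conjugacy class of proper subgroups once.  The
    missing class is that of [G] itself, whose coset space is the unit of the
    ring; its coordinate is the augmentation. *)
Section Span.
Variables (T : finType) (r : T -> {group gT}).
Hypothesis r_proper : forall t, r t \proper G.
Hypothesis r_conj : forall K, K \proper G -> exists t, (K : {set gT}) \in (r t :^: G)%g.
Hypothesis r_inj : forall s t, (r s : {set gT}) \in (r t :^: G)%g -> s = t.

Lemma coord_rep s t :
  orbit_coord (r s) (coset_class (r t)) = (s == t)%:R.
Proof.
rewrite coord_coset ?proper_sub //; congr (nat_of_bool _)%:R.
apply/idP/eqP=> [/r_inj-> //|->]; apply/imsetP; exists 1%g; by rewrite ?conjsg1.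
Qed.

Lemma burnside_decomposition u :
  u = (augmentation u)%:~R + \sum_t coset_class (r t) *~ orbit_coord (r t) u.
Proof.
elim/burnside_ind: u => [|u v eu ev|K sKG].
- rewrite raddf0 add0r big1 // => t _.
  by rewrite (raddf0 (coord_additive (proper_sub (r_proper t)))).
- rewrite {1}eu {1}ev opprD addrACA; congr (_ + _).
    have -> : augmentation (u - v) = augmentation u - augmentation v.
      exact: raddfB.
    by rewrite mulrzBr.
  rewrite -sumrB; apply: eq_bigr => t _.
  by rewrite (raddfB (coord_additive (proper_sub (r_proper t)))) mulrzBr.
have [/eqP eKG|nKG] := boolP ((K : {set gT}) == G).
  have -> : K = G by apply: group_inj.
  rewrite coset_class_full rmorph1 big1 ?addr0 // => t _.
  rewrite -coset_class_full coord_coset ?(proper_sub (r_proper t)) //.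
  case: imsetP => // -[a Ga e]; have /proper_card := r_proper t.
  by rewrite e cardJg ltnn.
have pK : K \proper G by rewrite properEneq nKG.
have [t Kt] := r_conj pK; rewrite augmentation_coset // add0r (bigD1 t) //=.
have [a Ga eK] := imsetP Kt.
have -> : K = (r t :^ a)%G by apply: group_inj.
rewrite coset_class_conj ?proper_sub // coord_rep eqxx big1 ?addr0 // => s nst.
by rewrite coord_rep (negPf nst).
Qed.

End Span.

End Stabilizers.

Local Open Scope group_scope.

(** * Finite p-groups *)

Lemma conjugates_refl (gT : finGroupType) (G K : {group gT}) :
  (K : {set gT}) \in K :^: G.
Proof. by apply/imsetP; exists 1; rewrite ?conjsg1. Qed.

Lemma proper_sub_maximal (gT : finGroupType) (G K : {group gT}) :
  K \proper G -> exists2 M : {group gT}, maximal M G & K \subset M.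
Proof.
by case/andP=> sKG nGK; case: (maximal_exists sKG) => // eK; rewrite eK subxx in nGK.
Qed.

Lemma dvdn_pgroup_index (p : nat) (gT : finGroupType) (G K : {group gT}) :
  p.-group G -> K \proper G -> (p %| #|G : K|)%N.
Proof.
move=> pG /andP[_ nGK]; have : p.-nat #|G : K| := pnat_dvd (dvdn_indexg _ _) pG.
case/p_natP=> -[|k] ek; last by rewrite ek expnS dvdn_mulr.
by case/negP: nGK; rewrite -indexg_eq1 ek.
Qed.

(** If the Frattini quotient is [C_p x C_p], then two distinct maximal
    subgroups meet exactly in the Frattini subgroup; proper subgroups that
    together generate [G] lie in distinct maximal subgroups. *)
Lemma cap_sub_Phi (p : nat) (gT : finGroupType) (G K L : {group gT}) :
    p.-group G -> (#|G| = p ^ 2 * #|'Phi(G)|)%N ->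
  K \proper G -> L \proper G -> K <*> L = G -> K :&: L \subset 'Phi(G).
Proof.
move=> pG oG prK prL defKL.
have [M1 max1 sKM1] := proper_sub_maximal prK.
have [M2 max2 sLM2] := proper_sub_maximal prL.
have [n1 n2] := (p_maximal_normal pG max1, p_maximal_normal pG max2).
have oM (M : {group gT}) : maximal M G -> (#|M| * p = #|G|)%N.
  move=> maxM; rewrite -(p_maximal_index pG maxM) Lagrange //.
  by case/maxgroupP: maxM => /proper_sub.
have defM : M1 * M2 = G.
  rewrite -norm_joinEl ?(subset_trans (normal_sub n1) (normal_norm n2)) //.
  have sGM : G \subset M1 <*> M2 by rewrite -defKL genS ?setUSS.
  by apply/eqP; rewrite eqEsubset join_subG (normal_sub n1) (normal_sub n2).
have p_gt0 : (0 < p)%N by have := cardG_gt0 G; rewrite oG; case: (p).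
have /eqP : (#|G| * #|G| = #|G| * (p ^ 2 * #|M1 :&: M2|))%N.
  rewrite -[X in (X * _)%N = _](oM M1 max1) -[X in (_ * X)%N = _](oM M2 max2).
  by rewrite mulnACA mul_cardG defM mulnAC -mulnA.
rewrite eqn_pmul2l // {1}oG eqn_pmul2l ?expn_gt0 ?p_gt0 // => /eqP oI.
suff -> : 'Phi(G) = M1 :&: M2 by apply: setISS.
by apply/eqP; rewrite eqEcard subsetI !Phi_sub_max //= -oI.
Qed.

(** * Subgroups of the modular group *)

(** The presentation differs from the one that defines ['Mod_(p ^ m.+1)] only in
    the form of the relations; each group is a quotient of the other. *)
Lemma modular_generators (p m : nat) (gT : finGroupType) (H : {group gT}) :
    prime p -> (1 < m)%N ->
    H \isog Grp (a : b : (a ^+ (p ^ m)%N = b ^+ p = 1,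
                          b^-1 * a * b = a ^+ (p ^ m.-1 + 1)%N)) ->
  exists x y, [/\ <[x]> ><| <[y]> = H, #[x] = (p ^ m)%N /\ #[y] = p,
    x ^ y = x ^+ (p ^ m.-1).+1, 'Phi(H) = <[x ^+ p]> &
    [/\ H^`(1) = <[x ^+ (p ^ m.-1)]>, H^`(1) \subset 'Z(H) & #|H^`(1)| = p]].
Proof.
move=> p_prime m_gt1 presH.
have isoM := Grp_modular_group p_prime (m_gt1 : (2 < m.+1)%N).
have isoH : H \isog 'Mod_(p ^ m.+1).
  rewrite isogEhom isoM presH.
  apply/andP; split.
    have /existsP[[a b] /eqP[defH ap bp ab]] := isoGrp_hom presH.
    apply/existsP; exists (a, b); rewrite /= !xpair_eqE defH ap bp /=.
    by rewrite /conjg mulgA ab addn1 !eqxx.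
  have /existsP[[a b] /eqP[defM ap bp ab]] := isoGrp_hom isoM.
  apply/existsP; exists (a, b); rewrite /= !xpair_eqE defM ap bp /=.
  by rewrite -mulgA -[b^-1 * _]/(a ^ b) ab addn1 !eqxx.
have [[x y] genH modH] := generators_modular_group p_prime (m_gt1 : (2 < m.+1)%N) isoH.
have [oH Hx ox _] := genH; have [oy xy] := modH.
have [[sdH _ _] [defZ defPhi _] [defD oD nilH] _ _] :=
  modular_group_structure p_prime (m_gt1 : (2 < m.+1)%N) genH isoH modH.
exists x, y; split=> //; first by rewrite defPhi defZ.
by split=> //; rewrite -nil_class2 nilH.
Qed.

Section ModularPGroup.
Variables (p m : nat) (gT : finGroupType) (H : {group gT}) (x y : gT).
Hypotheses (p_prime : prime p) (p_odd : odd p) (m_gt1 : (1 < m)%N).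
Hypotheses (sdH : <[x]> ><| <[y]> = H) (ox : #[x] = (p ^ m)%N) (oy : #[y] = p).
Hypotheses (xy : x ^ y = x ^+ (p ^ m.-1).+1) (defPhi : 'Phi(H) = <[x ^+ p]>).
Hypotheses (defD : H^`(1) = <[x ^+ (p ^ m.-1)]>) (sDZ : H^`(1) \subset 'Z(H)).
Hypothesis (oD : #|H^`(1)| = p).

Let p_gt0 : (0 < p)%N := prime_gt0 p_prime.
Let p_gt1 : (1 < p)%N := prime_gt1 p_prime.

Let nsxH : <[x]> <| H. Proof. by have /sdprod_context[] := sdH. Qed.

Let Hx : x \in H. Proof. by rewrite -cycle_subG normal_sub. Qed.

Let Hy : y \in H. Proof. by rewrite -cycle_subG; have /sdprod_context[] := sdH. Qed.

Let oH : #|H| = (p ^ m.+1)%N.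
Proof. by rewrite -(sdprod_card sdH) -!orderE ox oy -expnSr. Qed.

Let pH : p.-group H. Proof. by rewrite /pgroup oH pnatX pnat_id. Qed.

Let y_notin_x : y \notin <[x]>.
Proof.
have /sdprodP[_ _ _ tixy] := sdH; apply: contraL (p_gt1) => yx.
have : y \in <[x]> :&: <[y]> by rewrite inE yx cycle_id.
by rewrite tixy -oy => /set1P->; rewrite order1.
Qed.

Let oHPhi : (#|H| = p ^ 2 * #|'Phi(H)|)%N.
Proof.
rewrite oH defPhi -orderE orderXdiv ox; last by rewrite dvdn_exp // ltnW.
by case: (m) m_gt1 => // k _; rewrite [in RHS](expnS p k) mulKn // -expnD add2n.
Qed.

(** In class two, [(g h) ^ p] differs from [g ^ p h ^ p] by the power of exponent
    [p (p - 1) / 2] of a commutator.  Commutators have order dividing [p], and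
    this exponent is a multiple of [p] as [p] is odd. *)
Lemma expgM_p : {in H &, forall g h, (g * h) ^+ p = g ^+ p * h ^+ p}.
Proof.
move=> g h Hg Hh; have Dr : [~ h, g] \in H^`(1) by apply: mem_commg.
have := subsetP sDZ _ Dr => /centerP[_ cr].
rewrite expMg_Rmul; try exact/commute_sym/cr.
have -> : [~ h, g] ^+ 'C(p, 2) = 1; last by rewrite mulg1.
apply/eqP; rewrite -order_dvdn (dvdn_trans (order_dvdG Dr)) // oD.
by rewrite prime_dvd_bin // odd_prime_gt2.
Qed.

(** The subgroup of order [p ^ j] of [<x>], for [j <= m] ([order_Xsub]). *)
Definition Xsub j : {group gT} := <[x ^+ (p ^ (m - j))]>%G.

Lemma order_Xsub j : (j <= m)%N -> #|Xsub j| = (p ^ j)%N.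
Proof.
move=> lejm; rewrite -orderE orderXdiv ox ?dvdn_exp2l ?leq_subr //.
by rewrite -expnB ?leq_subr // subKn.
Qed.

Lemma mem_Xsub j a : (j <= m)%N -> (x ^+ a \in Xsub j) = (p ^ (m - j) %| a)%N.
Proof.
move=> lejm; apply/idP/idP=> [xaX|/dvdnP[b ->]]; last first.
  by rewrite mulnC expgM mem_cycle.
rewrite -(@dvdn_pmul2r (p ^ j)) ?expn_gt0 ?p_gt0 // -expnD subnK // -ox.
by rewrite order_dvdn expgM -order_dvdn -(order_Xsub lejm) order_dvdG.
Qed.

Lemma Xsub_sub j : Xsub j \subset <[x]>.
Proof. by rewrite cycle_subG mem_cycle. Qed.

Lemma Xsub_eq j (K : {group gT}) :
  (j <= m)%N -> K \subset <[x]> -> #|K| = (p ^ j)%N -> K = Xsub j.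
Proof.
move=> lejm sKx oK; apply/val_inj/eqP; rewrite (eq_subG_cyclic (cycle_cyclic x)) //=.
  by rewrite oK order_Xsub.
exact: Xsub_sub.
Qed.

Lemma Xsub_ex (K : {group gT}) :
  K \subset <[x]> -> exists2 j, (j <= m)%N & K = Xsub j.
Proof.
move=> sKx; have: #|K| %| (p ^ m)%N by rewrite -ox cardSg.
by case/(dvdn_pfactor _ _ p_prime)=> j lejm oK; exists j => //; apply: Xsub_eq.
Qed.

Lemma Xsub_normal j : Xsub j <| H.
Proof.
exact: char_normal_trans (cycle_subgroup_char (Xsub_sub j)) nsxH.
Qed.

Lemma Xsub_mS i j : (j <= m)%N -> (i <= j)%N -> Xsub i \subset Xsub j.
Proof.
by move=> lejm leij; rewrite cycle_subG mem_Xsub // dvdn_exp2l // leq_sub2l.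
Qed.

Lemma Xsub_m : Xsub m = <[x]> :> {set gT}.
Proof. by rewrite /= subnn. Qed.

Lemma Xsub_Phi j : (j < m)%N -> Xsub j \subset 'Phi(H).
Proof.
move=> ltjm; rewrite defPhi; have -> : x ^+ p = x ^+ (p ^ (m - m.-1)).
  by rewrite -subn1 subKn ?expn1 // ltnW.
by apply: (@Xsub_mS j m.-1); rewrite ?leq_pred // -ltnS prednK // (ltn_trans _ m_gt1).
Qed.

(** The elements [y x ^ u] whose [p]-th power [x ^ (u p)] lies in [Xsub j] are those
    for which [u] is a multiple [p ^ (m - j.+1) * k]; modulo [Xsub j], only [k]
    modulo [p] matters. *)
Definition yx j k := y * x ^+ (p ^ (m - j.+1) * k).

Definition Ksub j k : {group gT} := (Xsub j <*> <[yx j k]>)%G.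

Let Hyx j k : yx j k \in H. Proof. by rewrite groupM ?groupX. Qed.

Lemma yx_p j k : (j < m)%N -> yx j k ^+ p \in Xsub j.
Proof.
move=> ltjm; rewrite expgM_p ?groupX // -{1}oy expg_order mul1g -expgM.
by rewrite mem_Xsub 1?ltnW // mulnAC -expnSr subnSK // dvdn_mulr.
Qed.

Lemma yx_notin_x j k : yx j k \notin <[x]>.
Proof. by rewrite /yx groupMr ?mem_cycle. Qed.

Lemma Ksub_sub j k : Ksub j k \subset H.
Proof. by rewrite join_subG (normal_sub (Xsub_normal j)) cycle_subG Hyx. Qed.

Lemma Ksub_not_sub_x j k : ~~ (Ksub j k \subset <[x]>).
Proof.
apply/subsetPn; exists (yx j k); last exact: yx_notin_x.
by rewrite mem_gen // inE cycle_id orbT.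
Qed.

(** An element [t w ^ i] with [t] in [Xsub j] and [w = yx j k] lies in [<x>] only if
    [p] divides [i], because [w] is not in [<x>] while [w ^ p] is. *)
Lemma Ksub_cap j k : (j < m)%N -> Ksub j k :&: <[x]> = Xsub j.
Proof.
move=> ltjm; apply/eqP; rewrite eqEsubset subsetI joing_subl Xsub_sub !andbT.
rewrite /= norm_joinEr; last first.
  by rewrite cycle_subG; apply: subsetP (normal_norm (Xsub_normal j)) _ (Hyx j k).
apply/subsetP=> _ /setIP[/mulsgP[t _ Xt /cycleP[i ->] ->]].
have xt := subsetP (Xsub_sub j) t Xt; rewrite !groupMl // => wi.
have wp := yx_p k ltjm; have [/dvdnP[l ->]|npi] := boolP (p %| i)%N.
  by rewrite mulnC expgM groupX.
case/negP: (yx_notin_x j k).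
have i_gt0 : (0 < i)%N by case: (i) npi => //; rewrite dvdn0.
(* Otherwise a Bezout relation between i and p writes yx j k as a product of
   powers of its i-th and p-th powers, and puts it in <x>. *)
have /coprimeP[//|[u v] /= e] : coprime i p by rewrite coprime_sym prime_coprime.
have {}e : (u * i = (v * p).+1)%N.
  by rewrite -add1n -e subnK // ltnW // -subn_gt0 e.
have : yx j k ^+ (u * i) \in <[x]> by rewrite mulnC expgM groupX.
rewrite e expgS groupMr // mulnC expgM groupX //.
exact: subsetP (Xsub_sub j) _ wp.
Qed.

Lemma mul_not_sub_x (K : {group gT}) :
  K \subset H -> ~~ (K \subset <[x]>) -> K * <[x]> = H.
Proof.
move=> sKH nKx; have nxK : K \subset 'N(<[x]>).
  exact: subset_trans sKH (normal_norm nsxH).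
rewrite -norm_joinEl //; apply/eqP; apply: contraNT nKx => neKxH.
have : maximal <[x]> H.
  apply: (p_index_maximal (normal_sub nsxH)).
  by rewrite -divgS ?normal_sub // oH -orderE ox expnS mulnK // expn_gt0 p_gt0.
case/maxgroupP=> _ /(_ (K <*> <[x]>)%G) <-; rewrite ?joing_subl ?joing_subr //.
by rewrite properEneq neKxH join_subG sKH normal_sub.
Qed.

Lemma card_not_sub_x (K : {group gT}) :
  K \subset H -> ~~ (K \subset <[x]>) -> #|K| = (p * #|K :&: <[x]>|)%N.
Proof.
move=> sKH nKx; have := mul_cardG K <[x]>; rewrite mul_not_sub_x // oH.
rewrite -orderE ox expnS mulnAC => /eqP; rewrite eqn_pmul2r ?expn_gt0 ?p_gt0 //.
by move/eqP.
Qed.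

Lemma order_Ksub j k : (j < m)%N -> #|Ksub j k| = (p ^ j.+1)%N.
Proof.
move=> ltjm; rewrite card_not_sub_x ?Ksub_sub ?Ksub_not_sub_x // Ksub_cap //.
by rewrite order_Xsub ?expnS // ltnW.
Qed.

(** Since [K <x> = H], the subgroup [K] contains some [y x ^ u], and [K] is generated
    by this element and [K :&: <x>], which has index [p] in [K]. *)
Lemma Ksub_ex (K : {group gT}) : K \proper H -> ~~ (K \subset <[x]>) ->
  exists j k, [/\ (j < m)%N, (k < p)%N & K = Ksub j k].
Proof.
move=> /andP[sKH nHK] nKx; have defKx := mul_not_sub_x sKH nKx.
have [j lejm eXj] := Xsub_ex (subsetIr K <[x]>).
have eX : K :&: <[x]> = Xsub j by rewrite -eXj.
have [u Kyu] : exists u, y * x ^+ u \in K.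
  have : y \in K * <[x]> by rewrite defKx.
  case/mulsgP=> k z Kk; rewrite -groupV => /cycleP[i zi] ->; exists i.
  by rewrite -zi mulgK.
(* If K contained x, it would contain y as well and be equal to H. *)
have ltjm : (j < m)%N.
  rewrite ltn_neqAle lejm andbT; apply: contra nHK => /eqP ejm.
  have sxK : <[x]> \subset K by rewrite -Xsub_m -ejm -eX subsetIl.
  by rewrite -defKx mul_subG.
have /dvdnP[l el] : (p ^ (m - j.+1) %| u)%N.
  have : (y * x ^+ u) ^+ p \in K :&: <[x]>.
    rewrite inE groupX //= expgM_p ?groupX // -{1}oy expg_order mul1g -expgM.
    exact: mem_cycle.
  rewrite eX expgM_p ?groupX // -{1}oy expg_order mul1g -expgM mem_Xsub //.
  by rewrite -(subnSK ltjm) expnSr dvdn_pmul2r.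
exists j, (l %% p)%N; split; rewrite ?ltn_mod //.
apply/val_inj/eqP; rewrite eq_sym eqEcard join_subG.
rewrite -{1}eX subsetIl /= cycle_subG order_Ksub // card_not_sub_x // eX.
rewrite order_Xsub // expnS leqnn andbT.
move: Kyu; rewrite el {1}(divn_eq l p) mulnDl addnC expgD mulgA groupMr.
  by rewrite /yx mulnC.
have : x ^+ (l %/ p * p * p ^ (m - j.+1)) \in Xsub j.
  by rewrite mem_Xsub // -mulnA -expnS subnSK // dvdn_mull.
by rewrite -eX => /setIP[].
Qed.

(** Conjugating [y] by powers of [x] multiplies it by arbitrary elements of the
    derived group [Xsub 1]. *)
Lemma Ksub_conj k : exists2 a, a \in H & Ksub 0 k = (Ksub 0 0 :^ a)%G.
Proof.
exists (x ^- k); first by rewrite groupV groupX.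
have K0 l : Ksub 0 l = <[yx 0 l]> :> {set gT}.
  by rewrite /= subn0 -ox expg_order cycle1 joing1G.
apply: group_inj; rewrite [RHS]/= -[_ <*> _]/(gval (Ksub 0 0)) !K0 -cycleJ.
congr <[_]>; rewrite /yx muln0 expg0 mulg1 /conjg invgK mulgA.
have -> : x ^+ k * y = y * (x ^+ k) ^ y by rewrite -conjgC.
rewrite -mulgA conjXg xy -expgM; congr (_ * _).
by rewrite mulSn addnC expgD mulgK subn1.
Qed.

(** * Conjugacy classes of proper subgroups *)

(** The conjugacy classes of proper subgroups.  The left summand consists of the
    subgroups of the Frattini subgroup.  In the right one, [None] is [<x>], and
    [Some None] is the class of [<y>], which contains all the [Ksub 0 k]; the
    remaining [Ksub j k] have [0 < j], contain the derived group, and are their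
    own conjugacy classes. *)
Definition class_index := ('I_m + option (option ('I_m.-1 * 'I_p)))%type.

Definition rep (t : class_index) : {group gT} :=
  match t with
  | inl j => Xsub j
  | inr None => Xsub m
  | inr (Some None) => Ksub 0 0
  | inr (Some (Some (i, k))) => Ksub i.+1 k
  end.

Definition deep (t : class_index) := if t is inl _ then true else false.

Let ltS (i : 'I_m.-1) : (i.+1 < m)%N.
Proof. by have := ltn_ord i; rewrite -ltnS prednK // ltnW. Qed.

Lemma rep_normal t : t != inr (Some None) -> rep t <| H.
Proof.
case: t => [j|[[[i k]|]|]] //= _; try exact: Xsub_normal.
apply: sub_der1_normal (Ksub_sub _ _); rewrite defD.
have -> : <[x ^+ (p ^ m.-1)]> = Xsub 1 by rewrite /= subn1.
by apply: subset_trans (joing_subl _ _); apply: Xsub_mS; rewrite // ltnW.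
Qed.

Lemma rep_proper t : rep t \proper H.
Proof.
have sub (K : {group gT}) : (#|K| < p ^ m.+1)%N -> K \subset H -> K \proper H.
  by move=> ltK sKH; rewrite properEcard sKH oH.
case: t => [j|[[[i k]|]|]] /=; apply: sub.
- by rewrite order_Xsub ?(ltnW (ltn_ord j)) // ltn_exp2l // ltnS ltnW.
- exact: normal_sub (Xsub_normal _).
- by rewrite order_Ksub // ltn_exp2l // ltnS.
- exact: Ksub_sub.
- by rewrite order_Ksub ?ltn_exp2l // ltnW.
- exact: Ksub_sub.
- by rewrite order_Xsub // ltn_exp2l.
exact: normal_sub (Xsub_normal _).
Qed.

Lemma rep_conj (K : {group gT}) :
  K \proper H -> exists t, (K : {set gT}) \in rep t :^: H.
Proof.
move=> prK; have [sKx|nKx] := boolP (K \subset <[x]>).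
  have [j lejm ->] := Xsub_ex sKx; move: lejm; rewrite leq_eqVlt.
  case/predU1P=> [->|ltjm]; first by exists (inr None); apply: conjugates_refl.
  by exists (inl (Ordinal ltjm)); apply: conjugates_refl.
have [[|j] [k [ltjm ltkp ->]]] := Ksub_ex prK nKx.
  have [a Ha ->] := Ksub_conj k; exists (inr (Some None)); exact: imset_f.
have ltj : (j < m.-1)%N by rewrite -ltnS prednK // ltnW.
exists (inr (Some (Some (Ordinal ltj, Ordinal ltkp)))); exact: conjugates_refl.
Qed.

Lemma Ksub_inj j k l : (j < m)%N -> (k < p)%N -> (l < p)%N ->
  Ksub j k = Ksub j l -> k = l.
Proof.
move=> ltjm; wlog lekl : k l / (k <= l)%N => [hw ltk ltl e|_ ltlp eK].
  by case/orP: (leq_total k l) => le; [apply: hw | apply/esym/hw].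
have Kw i : yx j i \in Ksub j i by rewrite mem_gen // inE cycle_id orbT.
have : (yx j k)^-1 * yx j l \in Ksub j l :&: <[x]>.
  rewrite inE groupM ?groupV // -?eK //= /yx invMg -mulgA mulKg.
  by rewrite groupM ?groupV ?mem_cycle.
rewrite Ksub_cap // /yx invMg -mulgA mulKg -{1}(subnKC lekl) mulnDr expgD mulKg.
rewrite mem_Xsub 1?ltnW // -(subnSK ltjm) expnSr dvdn_pmul2l ?expn_gt0 ?p_gt0 //.
case: (posnP (l - k)) => [|kl /(dvdn_leq kl)].
  by move/eqP; rewrite subn_eq0 => lelk _; apply/eqP; rewrite eqn_leq lekl.
by rewrite leqNgt (leq_ltn_trans (leq_subr _ _)).
Qed.

(** The exponent of the order of the intersection with [<x>], see [rep_cap]. *)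
Definition level (t : class_index) : nat :=
  match t with
  | inl j => j
  | inr None => m
  | inr (Some None) => 0
  | inr (Some (Some (i, k))) => i.+1
  end.

Lemma level_le t : (level t <= m)%N.
Proof. by case: t => [j|[[[i k]|]|]] //=; rewrite ltnW. Qed.

Lemma rep_cap t : rep t :&: <[x]> = Xsub (level t).
Proof.
case: t => [j|[[[i k]|]|]]; first exact/setIidPl/Xsub_sub.
- exact: Ksub_cap.
- by apply: Ksub_cap; rewrite ltnW.
exact/setIidPl/Xsub_sub.
Qed.

(** The order of the intersection with [<x>], and whether the subgroup lies in [<x>],
    are invariant under conjugation; normality reduces what is left to
    [Ksub_inj]. *)
Lemma rep_inj s t : (rep s : {set gT}) \in rep t :^: H -> s = t.
Proof.
case/imsetP=> a Ha es.
have elev : level s = level t.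
  have := rep_cap s; rewrite es -{1}(normP (subsetP (normal_norm nsxH) a Ha)).
  rewrite -conjIg rep_cap (normP (subsetP (normal_norm (Xsub_normal _)) a Ha)).
  move/(congr1 (fun A : {set gT} => #|A|)); rewrite !order_Xsub ?level_le // => /eqP.
  by rewrite eqn_exp2l // => /eqP.
have esub : (rep s \subset <[x]>) = (rep t \subset <[x]>).
  by rewrite es -[in RHS](conjSg _ _ a) (normP (subsetP (normal_norm nsxH) a Ha)).
have normal_eq : t != inr (Some None) -> rep s = rep t.
  move/rep_normal/normal_norm/subsetP=> nt; apply: group_inj; rewrite es.
  exact/normP/nt.
case: s t elev esub normal_eq {es} => [j|[[[i k]|]|]] [j'|[[[i' k']|]|]] //=;
  rewrite ?Xsub_sub ?(negPf (Ksub_not_sub_x _ _)) // => e.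
- by move=> _ _; congr inl; apply: val_inj.
- by have := ltn_ord j; rewrite e ltnn.
- case: e => e _ /(_ isT); rewrite (val_inj e) => /Ksub_inj ek.
  by do 3!congr Some || congr inr; congr (_, _); apply/val_inj/ek.
by have := ltn_ord j'; rewrite -e ltnn.
Qed.

Lemma rep_sub_Phi t : (rep t \subset 'Phi(H)) -> deep t.
Proof.
case: t => [j|[[[i k]|]|]] //= s.
- have := Ksub_not_sub_x i.+1 k; rewrite (subset_trans s) // defPhi.
  by rewrite cycle_subG mem_cycle.
- have := Ksub_not_sub_x 0 0; rewrite (subset_trans s) // defPhi.
  by rewrite cycle_subG mem_cycle.
have := subset_leq_card s; rewrite order_Xsub // defPhi -orderE orderXdiv ox.
  by rewrite leqNgt ltn_Pdiv // expn_gt0 p_gt0.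
by rewrite dvdn_exp // ltnW.
Qed.

Lemma sub_Phi_rep (K : {group gT}) :
  K \subset 'Phi(H) -> exists t, deep t /\ K = rep t.
Proof.
move=> sKF; have sKx : K \subset <[x]>.
  by apply: subset_trans sKF _; rewrite defPhi cycle_subG mem_cycle.
have [j lejm eK] := Xsub_ex sKx; move: lejm; rewrite leq_eqVlt.
case/predU1P=> [ejm|ltjm]; last by exists (inl (Ordinal ltjm)).
have eKm : K = Xsub m by rewrite eK ejm.
by exists (inr None); split=> //; apply: rep_sub_Phi; rewrite -[rep _]/(Xsub m) -eKm.
Qed.

(** * Augmentation quotients of the modular group *)

Local Notation I := (@augmentation_ideal gT H).
Let e t := coset_class H (rep t).
Let rep_sub t : rep t \subset H := proper_sub (rep_proper t).
Let c t := coord_additive (rep_sub t).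

Let e_in t : e t \in I.
Proof. by rewrite mem_augmentation_ideal augmentation_coset ?rep_proper. Qed.

Let coord_rep_eq s t : c s (e t) = (s == t)%:R%R.
Proof. exact: (coord_rep rep_proper rep_inj). Qed.

Let span_rep u : u \in I -> (u = \sum_t e t *~ c t u)%R.
Proof.
rewrite mem_augmentation_ideal => /eqP u0.
by rewrite {1}(burnside_decomposition rep_proper rep_conj rep_inj u) u0 add0r.
Qed.

Let mul_maximal t : exists2 u, u \in I & (u * e t = e t *+ p)%R.
Proof.
have [M maxM sNM] := proper_sub_maximal (rep_proper t).
have prM : M \proper H by case/maxgroupP: maxM.
exists (coset_class H M); first by rewrite mem_augmentation_ideal augmentation_coset.
rewrite mulrC coset_class_mul ?(p_maximal_normal pH maxM) //.
have -> : (rep t :&: M)%G = rep t by apply: group_inj; apply/setIidPl.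
by rewrite (joing_idPr sNM) (p_maximal_index pH maxM).
Qed.

(* The factors are the coset spaces of <x> and of Ksub j 0, which generate H and
   meet in Xsub j. *)
Let deep_factor t : deep t -> e t \in ideal_exp I 2.
Proof.
case: t => // j _.
have -> : e (inl j) = (coset_class H (Ksub j 0) * e (inr None))%R.
  rewrite coset_class_mul ?Ksub_sub ?rep_normal //.
  have -> : (Ksub j 0 :&: rep (inr None))%G = rep (inl j).
    by apply: group_inj; rewrite [RHS]/= -(Ksub_cap 0 (ltn_ord j)) -Xsub_m.
  rewrite [_ <*> _]norm_joinEl; last first.
    by apply: subset_trans (Ksub_sub _ _) (normal_norm (rep_normal _)).
  by rewrite Xsub_m mul_not_sub_x ?Ksub_sub ?Ksub_not_sub_x // indexgg.
apply: mem_ideal_mul; first rewrite mem_augmentation_ideal augmentation_coset //.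
  rewrite properEcard Ksub_sub order_Ksub // oH ltn_exp2l //.
  by rewrite ltnS ltn_ord.
by rewrite ideal_exp1 ?e_in //; apply: augmentation_idealM.
Qed.

(* Nongenerators: a proper subgroup and a subgroup of the Frattini subgroup never
   generate H, so the index in the product formula is divisible by p. *)
Let deep_absorb s t : deep t ->
  exists k u, deep u /\ (e s * e t = e u *+ (p * k))%R.
Proof.
case: t => // j _.
have sXF : Xsub j \subset 'Phi(H) := Xsub_Phi (ltn_ord j).
have [u [gu eu]] : exists u, deep u /\ (rep s :&: Xsub j)%G = rep u.
  by apply: sub_Phi_rep; apply: subset_trans (subsetIr _ _) sXF.
have : rep s <*> Xsub j \proper H.
  rewrite properEneq join_subG rep_sub normal_sub ?Xsub_normal // !andbT.
  apply/eqP=> defH'; have /andP[_ /negP[]] := rep_proper s.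
  have sHF : H \subset rep s <*> 'Phi(H).
    by have := genS (setUS (rep s) sXF); rewrite [<<_ :|: Xsub j>>]defH'.
  have eF : 'Phi(H) <*> rep s = H.
    by apply/eqP; rewrite joingC eqEsubset join_subG Phi_sub rep_sub.
  by have := Phi_nongen eF; rewrite genGid => ->.
case/(dvdn_pgroup_index pH)/dvdnP=> k ek; exists k, u; split=> //.
by rewrite /e coset_class_mul ?Xsub_normal //= eu ek mulnC.
Qed.

Let shallow_coord_normal s t u : t != inr (Some None) -> ~~ deep u ->
  (p %| c u (e s * e t)%R)%Z.
Proof.
move=> nt bu; have nrt := rep_normal nt.
rewrite /e coset_class_mul // raddfMn /=.
have [defst|nst] := eqVneq (rep s <*> rep t) H; last first.
  have /(dvdn_pgroup_index pH)/dvdnP[k ->] : rep s <*> rep t \proper H.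
    by rewrite properEneq nst join_subG !rep_sub.
  by rewrite mulrnA -[(_ *+ p)%R]mulr_natr natz dvdz_mull.
have sJF := cap_sub_Phi pH oHPhi (rep_proper s) (rep_proper t) defst.
rewrite coord_coset ?(subset_trans sJF) ?Phi_sub //.
case: imsetP => [[a Ha eJ]|_]; last by rewrite mul0rn dvdz0.
case/negP: bu; apply: rep_sub_Phi.
by rewrite -(conjSg _ _ a) -eJ (normsP (gFnorm _ _)).
Qed.

Let shallow_coord s t u : ~~ deep u -> (p %| c u (e s * e t)%R)%Z.
Proof.
move=> bu; have [et|nt] := eqVneq t (inr (Some None)); last exact: shallow_coord_normal.
have [es|ns] := eqVneq s (inr (Some None)); last first.
  by rewrite mulrC; apply: shallow_coord_normal.
(* Both factors are the class of <y>, the only nonnormal one.  Its own coordinate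
   in the square is the index of <y> in its normalizer; a stabilizer in
   the product that is not conjugate to <y> is properly contained in a conjugate
   of <y>, hence trivial, and the trivial group is deep. *)
rewrite {}es {}et; set b := inr (Some None); have [->|nu] := eqVneq u b.
  have -> : c b (e b * e b)%R = #|'N_H(rep b) : rep b|.
    exact: coord_sqr (rep_sub b).
  have pN := nilpotent_proper_norm (pgroup_nil pH) (rep_proper b).
  rewrite dvdzE /=; apply: dvdn_pgroup_index pN.
  exact: pgroupS (subsetIl _ _) pH.
have -> : c u (e b * e b)%R = 0%R; last exact: dvdz0.
apply: coord_mul_eq0 (rep_sub b) _ => a Ha.
apply: contra nu => sua; apply/eqP/rep_inj/imsetP; exists a => //.
have ob : #|rep b| = p by rewrite order_Ksub ?expn1 // ltnW.
apply/eqP; rewrite eqEcard sua cardJg ob /=.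
have : #|rep u| %| p by have := cardSg sua; rewrite cardJg ob.
case/primeP: p_prime => _ h /h/orP[/eqP u1|/eqP-> //].
by case/negP: bu; apply: rep_sub_Phi; rewrite (card1_trivg u1) sub1G.
Qed.

Lemma augmentation_quotient_modular n :
  zmod_isomorphic (augmentation_quotient H n.+1)
    'rV['F_p]_(if n == 0%N then (m - 1) * p + 2 else (m - 1) * p + m + 2)%N.
Proof.
have := ideal_quotient_iso p_prime (I := I) (@augmentation_idealM gT H)
  e_in coord_rep_eq span_rep mul_maximal deep_factor shallow_coord deep_absorb n.
have cardT : #|{: option (option ('I_m.-1 * 'I_p))}| = ((m - 1) * p + 2)%N.
  by rewrite !card_option card_prod !card_ord subn1 addn2.
have -> : #|[pred t | ~~ deep t]| = ((m - 1) * p + 2)%N.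
  rewrite -cardT -[RHS](card_imset _ (@inr_inj 'I_m _)); apply: eq_card => -[j|u].
    by rewrite !inE /=; apply/esym/imsetP=> -[].
  by rewrite !inE /=; apply/esym/imsetP; exists u.
by rewrite card_sum card_ord cardT addnCA addnA.
Qed.

End ModularPGroup.

Theorem theorem4p2 (p m n : nat) (gT : finGroupType) (H : {group gT})
    (p_prime : prime p) (p_odd : odd p) (m_ge3 : (3 <= m)%N)
    (presH : H \isog Grp (a : b : (a ^+ (p ^ m)%N = b ^+ p = 1,
                                   b^-1 * a * b = a ^+ (p ^ m.-1 + 1)%N)))
    (n_gt0 : (0 < n)%N) :
  zmod_isomorphic (augmentation_quotient H n)
    'rV['F_p]_(if n == 1%N then ((m - 1) * p + 2)%N
               else ((m - 1) * p + m + 2)%N).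
Proof.
have [x [y [sdH [ox oy] xy defPhi [defD sDZ oD]]]] :=
  modular_generators p_prime (ltnW m_ge3) presH.
case: n n_gt0 => // n _; rewrite eqSS.
exact: (augmentation_quotient_modular p_prime p_odd (ltnW m_ge3) sdH ox oy xy
  defPhi defD sDZ oD).
Qed.
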